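(* Let $n=3\widetilde{n}=3p_1\cdots p_t$ with primes $p_i\neq 2,3$. Let $$C_1=\begin{pmatrix} 1 & 0 & 0 & 1 & 0 & 0 & O & O\\ 0 & 1 & 0 & 1 & 0 & 1 & O & r_{-1}\\ 0 & 0 & 0 & 0 & 1 & 0 & O & O\\ 1 & 1 & 1 & 0 & 0 & 1 & r_{-1} & r_2\\ 1 & 1 & 1+[\frac{-3}{\widetilde{n}}] & 0 & 0 & 0 & r_{-3} & O\\ 0 & 0 & 1+[\frac{-3}{\widetilde{n}}] & 1 & 1 & [\frac{-3}{\widetilde{n}}] & O & r_{-3}\\ O & O & O & r_{-1}^T & r_{2}^T & r_{3}^T & D_{-3} & A+D_{3}\\ r_{-1}^T & r_{2}^T & r_{3}^T & O & O & O & A+D_{-3} & O \end{pmatrix},\quad C_2=\begin{pmatrix} 1 & 0 & 0 & 1 & 0 & 0 & O & O\\ 0 & 0 & 0 & 0 & 1 & 0 & O & O\\ 0 & 1 & 0 & 0 & 0 & 0 & O & O\\ 0 & 0 & 0 & 1 & 0 & 1 & O & r_{-1}\\ 1 & 1 & 1+[\frac{-3}{\widetilde{n}}] & 0 & 0 & 0 & r_{-3} & O\\ 0 & 0 & 1+[\frac{-3}{\widetilde{n}}] & 1 & 1 & [\frac{-3}{\widetilde{n}}] & O & r_{-3}\\ O & O & O & r_{-1}^T & r_{2}^T & r_{3}^T & D_{-3} & A+D_{3}\\ r_{-1}^T & r_{2}^T & r_{3}^T & O & O & O & A+D_{-3} & O \end{pmatrix},$$ $$C_3=\begin{pmatrix}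 1 & 0 & 0 & 1 & 0 & 0 & O & O\\ 0 & 1 & 0 & 0 & 0 & 0 & O & O\\ 0 & 0 & 0 & 0 & 1 & 0 & O & O\\ 1 & 0 & 1 & 0 & 0 & 0 & r_{-1} & O\\ 1 & 1 & 1+[\frac{-3}{\widetilde{n}}] & 0 & 0 & 0 & r_{-3} & O\\ O & O & 1+[\frac{-3}{\widetilde{n}}] & 1 & 1 & [\frac{-3}{\widetilde{n}}] & O & r_{-3}\\ O & O & O & r_{-1}^T & r_{2}^T & r_{3}^T & D_{-3} & A+D_{3}\\ r_{-1}^T & r_{2}^T & r_{3}^T & O & O & O & A+D_{-3} & O \end{pmatrix}.$$ Then the Monsky matrix of $E_n$ is $$M_n=\begin{cases} C_1, &\text{if } \widetilde{n}\equiv 3\pmod{8},\\ C_2, &\text{if } \widetilde{n}\equiv 7\pmod{8}, \\ C_3, &\text{if } \widetilde{n}\equiv 1\pmod{4}. \end{cases}$$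
   Context: Let $n$ be a nonzero squarefree integer and $E_n: y^2=x(x+3n)(x-n)$ (the curve attached to $\pi/3$-congruent numbers, twisted by $n$). Write $\widetilde{n}=|n/\gcd(6,n)|=p_1\cdots p_t$ with primes $p_i\neq 2,3$. Every element of $\mathrm{Sel}_2(E_n)$ is represented by a pair $(b_1,b_2)$ with $b_1=(-1)^{\gamma_1}2^{\gamma_2}3^{\gamma_3}\prod_i p_i^{x_i}$, $b_2=(-1)^{\xi_1}2^{\xi_2}3^{\xi_3}\prod_i p_i^{y_i}$, exponents in $\{0,1\}$, encoded by $v^T=(\xi_1,\xi_2,\xi_3,\gamma_1,\gamma_2,\gamma_3,y_1,\dots,y_t,x_1,\dots,x_t)\in\mathbb{F}_2^{2t+6}$. A Monsky matrix of $E_n$ is a matrix $M_n$ over $\mathbb{F}_2$ such that this encoding is a bijection between $\mathrm{Sel}_2(E_n)$ and $\{v: M_nv=0\}$. $[\frac{a}{p}]=\frac12(1-(\frac{a}{p}))\in\mathbb{F}_2$ is the additive Legendre symbol, $[\frac{a}{\widetilde n}]=\sum_i[\frac{a}{p_i}]$. For $d$ coprime to $\widetilde{n}$, $r_d=([\frac{d}{p_1}],\dots,[\frac{d}{p_t}])$ (row vector) and $D_d=\mathrm{diag}(r_d)$. $A=(a_{ij})$ is the $t\times t$ matrix over $\mathbb{F}_2$ with $a_{ij}=[\frac{p_j}{p_i}]$ for $i\neq j$, $a_{ii}=\sum_{j\neq i}a_{ij}$. $O$ denotes a zero block. *)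

(* Defs.v *)
From HB Require Import structures.
From mathcomp Require Import all_boot all_order all_algebra.
From mathcomp Require Import boolp classical_sets functions.
From mathcomp Require Import Rstruct.
From Stdlib Require Rdefinitions.

Set Implicit Arguments.
Unset Strict Implicit.
Unset Printing Implicit Defensive.

Import GRing.Theory Num.Theory.
Local Open Scope ring_scope.

Record prime_nat := PrimeNat { prime_val :> nat; primeP : prime prime_val }.

(* Z_p as the inverse limit of the Z/p^k: the residue at level k is the
   representative in [0, p^k), and the coherence condition
   x_k = (x_(k+1) mod p^k) also forces x_k to lie in that range. *)
Record Zp (p : prime_nat) := MkZp {
  residue :> nat -> int;
  residue_coh : `[< forall k, residue k = (residue k.+1 %% (p ^ k)%N)%Z >]
}.

Section Zp.
Variable p : prime_nat.
Local Notation q k := (Posz (p ^ k)%N).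
Implicit Types x y z : Zp p.

Lemma q_neq0 k : q k != 0.
Proof. by rewrite eqz_nat -lt0n expn_gt0 prime_gt0 // primeP. Qed.

Lemma residueS x k : x k = (x k.+1 %% q k)%Z.
Proof. by have /asboolP := residue_coh x. Qed.

Lemma residue_mod x k : (x k %% q k)%Z = x k.
Proof. by rewrite residueS modz_mod. Qed.

Lemma Zp_eqP x y : (forall k, x k = y k) -> x = y.
Proof.
case: x y => [f hf] [g hg] /= /funext efg; rewrite efg in hf *.
by congr MkZp; exact: Prop_irrelevance.
Qed.

Lemma modz_q (m : int) k j : ((m %% q (k + j))%Z %% q k)%Z = (m %% q k)%Z.
Proof.
rewrite [m in RHS](divz_eq m (q (k + j))); set r := (m %% _)%Z.
by rewrite expnD PoszM [X in X + r]mulrCA [X in X + r]mulrC modzMDl.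
Qed.

Lemma coherent_proof (f : nat -> int) :
    (forall k, (f k.+1 = f k %[mod q k])%Z) ->
  `[< forall k, (f k %% q k)%Z = ((f k.+1 %% q k.+1)%Z %% q k)%Z >].
Proof.
by move=> hf; apply/asboolP => k; rewrite -hf -addn1 modz_q.
Qed.

Definition coherent f hf : Zp p := MkZp (@coherent_proof f hf).

Lemma intZp_proof (m : int) k : (m = m %[mod q k])%Z. Proof. by []. Qed.
Lemma oppZp_proof x k : (- x k.+1 = - x k %[mod q k])%Z.
Proof. by rewrite (residueS x k) modzNm. Qed.
Lemma addZp_proof x y k : (x k.+1 + y k.+1 = x k + y k %[mod q k])%Z.
Proof. by rewrite (residueS x k) (residueS y k) modzDm. Qed.
Lemma mulZp_proof x y k : (x k.+1 * y k.+1 = x k * y k %[mod q k])%Z.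
Proof. by rewrite (residueS x k) (residueS y k) modzMm. Qed.

Definition intZp m := coherent (f := fun=> m) (intZp_proof m).
Definition oppZp x := coherent (oppZp_proof x).
Definition addZp x y := coherent (addZp_proof x y).
Definition mulZp x y := coherent (mulZp_proof x y).

HB.instance Definition _ := gen_eqMixin (Zp p).
HB.instance Definition _ := gen_choiceMixin (Zp p).

Lemma addZpA : associative addZp.
Proof. by move=> x y z; apply: Zp_eqP => k /=; rewrite modzDmr modzDml addrA. Qed.
Lemma addZpC : commutative addZp.
Proof. by move=> x y; apply: Zp_eqP => k /=; rewrite addrC. Qed.
Lemma add0Zp : left_id (intZp 0) addZp.
Proof. by move=> x; apply: Zp_eqP => k /=; rewrite mod0z add0r residue_mod. Qed.
Lemma addNZp : left_inverse (intZp 0) oppZp addZp.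
Proof. by move=> x; apply: Zp_eqP => k /=; rewrite modzDml addNr. Qed.

HB.instance Definition _ :=
  GRing.isZmodule.Build (Zp p) addZpA addZpC add0Zp addNZp.

Lemma mulZpA : associative mulZp.
Proof. by move=> x y z; apply: Zp_eqP => k /=; rewrite modzMmr modzMml mulrA. Qed.
Lemma mulZpC : commutative mulZp.
Proof. by move=> x y; apply: Zp_eqP => k /=; rewrite mulrC. Qed.
Lemma mul1Zp : left_id (intZp 1) mulZp.
Proof.
by move=> x; apply: Zp_eqP => k /=; rewrite modzMml mul1r residue_mod.
Qed.
Lemma mulZpDl : left_distributive mulZp addZp.
Proof.
by move=> x y z; apply: Zp_eqP => k /=; rewrite modzMml modzDm mulrDl.
Qed.
Lemma oneZp_neq0 : intZp 1 != 0.
Proof.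
apply/eqP => /(congr1 (fun x : Zp p => x 1%N)) /eqP /=.
by rewrite expn1 mod0z modz_small // ltz_nat prime_gt1 // primeP.
Qed.

HB.instance Definition _ := GRing.Zmodule_isComNzRing.Build (Zp p)
  mulZpA mulZpC mul1Zp mulZpDl oneZp_neq0.

Definition unitZp : pred (Zp p) := fun x => `[< exists y, y * x = 1 >].

Definition invZp x : Zp p :=
  if pselect (exists y, y * x = 1) is left ex then projT1 (cid ex) else x.

Lemma mulVZp : {in unitZp, left_inverse 1 invZp *%R}.
Proof.
move=> x /asboolP ux; rewrite /invZp; case: pselect => // ex.
by case: (cid ex).
Qed.
Lemma unitZpPl x y : y * x = 1 -> unitZp x.
Proof. by move=> yx; apply/asboolP; exists y. Qed.
Lemma invZp_out : {in [predC unitZp], invZp =1 id}.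
Proof.
by move=> x /asboolP nux; rewrite /invZp; case: pselect => // ex; case: nux.
Qed.

HB.instance Definition _ := GRing.ComNzRing_hasMulInverse.Build (Zp p)
  mulVZp unitZpPl invZp_out.

Lemma residue_add x k j : (x (k + j)%N = x k %[mod q k])%Z.
Proof.
elim: j => [|j IHj]; first by rewrite addn0.
by rewrite -IHj addnS (residueS x (k + j)) modz_q.
Qed.

Lemma residue_neq0 x : x != 0 -> exists k, forall j, ~~ (q k %| x (k + j)%N)%Z.
Proof.
move=> /eqP nx; apply: contrapT => /forallNP h; apply: nx; apply: Zp_eqP => k.
have /existsNP [j] := h k; move=> /negP; rewrite negbK => /dvdz_mod0P.
by rewrite residue_add residue_mod => -> /=; rewrite mod0z.
Qed.

Lemma Zp_integral x y : x * y = 0 -> (x == 0) || (y == 0).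
Proof.
move=> xy0; apply/negPn/negP; rewrite negb_or => /andP[].
move=> /residue_neq0 [a xa] /residue_neq0 [b yb].
have : (q (a + b) %| x (a + b)%N * y (a + b)%N)%Z.
  apply/dvdz_mod0P; have := congr1 (fun z : Zp p => z (a + b)%N) xy0.
  by rewrite /= mod0z.
move: (xa b) (yb a); rewrite [(b + a)%N]addnC !dvdzE /= abszM.
move: `|x _|%N `|y _|%N => m n pam pbn; apply/negP.
have pr := primeP p.
have m0 : (0 < m)%N by case: m pam => //; rewrite dvdn0.
have n0 : (0 < n)%N by case: n pbn => //; rewrite dvdn0.
rewrite pfactor_dvdn ?muln_gt0 ?m0 // lognM //.
move: pam pbn; rewrite !pfactor_dvdn // -!ltnNge => ma nb.
by rewrite -addSn leq_add // ltnW.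
Qed.

HB.instance Definition _ :=
  GRing.ComUnitRing_isIntegral.Build (Zp p) Zp_integral.

End Zp.

Definition Qp (p : prime_nat) : fieldType := {fraction (Zp p)}.

(* A point of P^3(K) on the smooth projective 2-covering C_(b1,b2) of
   y^2 = (x - e1)(x - e2)(x - e3); away from z0 = 0 it maps to the point with
   x - e1 = b1 (z1/z0)^2, x - e2 = b2 (z2/z0)^2, x - e3 = b1 b2 (z3/z0)^2. *)
Definition covering_has_point (K : fieldType) (e1 e2 e3 b1 b2 : rat) : Prop :=
  exists z0 z1 z2 z3 : K,
    [/\ ~~ [&& z0 == 0, z1 == 0, z2 == 0 & z3 == 0],
        ratr b1 * z1 ^+ 2 - ratr b2 * z2 ^+ 2 = ratr (e2 - e1) * z0 ^+ 2
      & ratr b1 * z1 ^+ 2 - ratr (b1 * b2) * z3 ^+ 2 = ratr (e3 - e1) * z0 ^+ 2].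

Definition everywhere_locally_soluble (e1 e2 e3 b1 b2 : rat) : Prop :=
  covering_has_point Rdefinitions.R e1 e2 e3 b1 b2 /\
  forall p : prime_nat, covering_has_point (Qp p) e1 e2 e3 b1 b2.

(* The class of b in Q^* / Q^*^2, as a coset. *)
Definition sqclass (b : rat) : set rat :=
  [set c | exists2 r : rat, r != 0 & c = b * r ^+ 2].

(* H^1(Q, E[2]) is identified with (Q^*/Q^*^2)^2 through the 2-torsion points
   (e1, 0) and (e2, 0). *)
Definition Sel2 (e1 e2 e3 : rat) : set (set rat * set rat) :=
  [set c | exists b1 b2 : rat,
    [/\ b1 != 0, b2 != 0, everywhere_locally_soluble e1 e2 e3 b1 b2
      & c = (sqclass b1, sqclass b2)]].

(* E_n : y^2 = x (x + 3n) (x - n), with (b1, b2) the classes of (x, x - n). *)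
Definition Sel2_E (n : int) : set (set rat * set rat) :=
  Sel2 0 n%:~R (- (3 * n)%:~R).

Section Monsky.
Variables (t : nat) (p : 'I_t -> nat).

(* A vector of exponents is the column
   (xi1, xi2, xi3, gamma1, gamma2, gamma3, y_1, ..., y_t, x_1, ..., x_t). *)
Definition head_exp (v : 'cV['F_2]_(6 + (t + t))) (k : nat) : nat :=
  usubmx v (inord k) 0.
Definition y_exp (v : 'cV['F_2]_(6 + (t + t))) (i : 'I_t) : nat :=
  usubmx (dsubmx v) i 0.
Definition x_exp (v : 'cV['F_2]_(6 + (t + t))) (i : 'I_t) : nat :=
  dsubmx (dsubmx v) i 0.

Definition decode1 (v : 'cV['F_2]_(6 + (t + t))) : rat :=
  (-1) ^+ head_exp v 3 * 2 ^+ head_exp v 4 * 3 ^+ head_exp v 5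
  * \prod_i (p i)%:R ^+ x_exp v i.
Definition decode2 (v : 'cV['F_2]_(6 + (t + t))) : rat :=
  (-1) ^+ head_exp v 0 * 2 ^+ head_exp v 1 * 3 ^+ head_exp v 2
  * \prod_i (p i)%:R ^+ y_exp v i.

Definition decode (v : 'cV['F_2]_(6 + (t + t))) : set rat * set rat :=
  (sqclass (decode1 v), sqclass (decode2 v)).

Definition is_Monsky_matrix (n : int) (m : nat)
    (M : 'M['F_2]_(m, 6 + (t + t))) : Prop :=
  set_bij [set v | M *m v = 0] (Sel2_E n) decode.

End Monsky.

(* (1 - (a/l)) / 2 is exact only when l does not divide a, which is the case
   wherever add_legendre is used below. *)
Definition legendre (a : int) (l : nat) : int :=
  if (l %| a)%Z then 0
  else if [exists x : 'I_l, (x%:Z ^+ 2 == a %[mod l])%Z] then 1 else -1.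

Definition add_legendre (a : int) (l : nat) : 'F_2 :=
  ((1 - legendre a l) %/ 2)%Z%:~R.

Section Matrices.
Variables (t : nat) (p : 'I_t -> nat).

Definition add_legendre_prod (a : int) : 'F_2 := \sum_i add_legendre a (p i).

Definition r_ (d : int) : 'rV['F_2]_t := \row_i add_legendre d (p i).
Definition D_ (d : int) : 'M['F_2]_t := diag_mx (r_ d).

Definition A_ : 'M['F_2]_t :=
  \matrix_(i, j) if i == j then \sum_(k | k != i) add_legendre (p k) (p i)
                 else add_legendre (p j) (p i).

(* Y and X are the blocks facing the coordinates y_i and x_i respectively. *)
Definition mxline (s : seq 'F_2) (Y X : 'rV['F_2]_t) :
    'rV['F_2]_(6 + (t + t)) :=
  row_mx (\row_(j < 6) s`_j) (row_mx Y X).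
Definition mxband (s : seq 'cV['F_2]_t) (Y X : 'M['F_2]_t) :
    'M['F_2]_(t, 6 + (t + t)) :=
  row_mx (\matrix_(i < t, j < 6) s`_j i 0) (row_mx Y X).

Local Notation O := 0.
Local Notation e := (add_legendre_prod (-3)).
Local Notation r d := (r_ d).
Local Notation D d := (D_ d).

Definition C_low : 'M['F_2]_(1 + (1 + (t + t)), 6 + (t + t)) :=
  col_mx (mxline [:: 1; 1; 1 + e; 0; 0; 0] (r (-3)) O) (
  col_mx (mxline [:: 0; 0; 1 + e; 1; 1; e] O (r (-3))) (
  col_mx
    (mxband [:: O; O; O; (r (-1))^T; (r 2)^T; (r 3)^T] (D (-3)) (A_ + D 3))
    (mxband [:: (r (-1))^T; (r 2)^T; (r 3)^T; O; O; O] (A_ + D (-3)) O))).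

Definition C_stack (l1 l2 l3 l4 : 'rV['F_2]_(6 + (t + t))) :
    'M['F_2]_(6 + (t + t)) :=
  col_mx l1 (col_mx l2 (col_mx l3 (col_mx l4 C_low))).

Definition C1 : 'M['F_2]_(6 + (t + t)) := C_stack
  (mxline [:: 1; 0; 0; 1; 0; 0] O O)
  (mxline [:: 0; 1; 0; 1; 0; 1] O (r (-1)))
  (mxline [:: 0; 0; 0; 0; 1; 0] O O)
  (mxline [:: 1; 1; 1; 0; 0; 1] (r (-1)) (r 2)).

Definition C2 : 'M['F_2]_(6 + (t + t)) := C_stack
  (mxline [:: 1; 0; 0; 1; 0; 0] O O)
  (mxline [:: 0; 0; 0; 0; 1; 0] O O)
  (mxline [:: 0; 1; 0; 0; 0; 0] O O)
  (mxline [:: 0; 0; 0; 1; 0; 1] O (r (-1))).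

Definition C3 : 'M['F_2]_(6 + (t + t)) := C_stack
  (mxline [:: 1; 0; 0; 1; 0; 0] O O)
  (mxline [:: 0; 1; 0; 0; 0; 0] O O)
  (mxline [:: 0; 0; 0; 0; 1; 0] O O)
  (mxline [:: 1; 0; 1; 0; 0; 0] (r (-1)) O).

End Matrices.

(* Main.v *)
(* The curve C_(b1,b2) is b1 z1^2 - b2 z2^2 = n z0^2, b1 z1^2 - b1 b2 z3^2 = -3n z0^2,
   and the kernel condition M v = 0 is shown to be solubility of C_(b1,b2) at each place.
   At infinity this says that b1 and b2 have the same sign.  At 3 and at the primes
   dividing nt, reducing a primitive solution modulo p shows that the soluble classes are
   exactly the images (1,1), (-3,-n), (n,1), (-3n,-n) of the four 2-torsion points, which
   is linear in the exponents.  At 2 everything depends on classes modulo 8: solubility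
   modulo 16 is necessary, and Hensel's lemma turns explicit points into sufficiency.  At
   the remaining primes p, solubility forces b1 and b2 to have even valuation; conversely
   if b1 and b2 are units then a character sum (all 2-coverings of an elliptic curve over
   F_p have the same number of points as the curve) gives a point modulo p, which lifts.
   The supplementary laws for -1, 2 and -3 turn the conditions at 2 and 3 into the entries
   of the matrices. *)
From HB Require Import structures.
From mathcomp Require Import all_boot all_order all_algebra all_solvable all_field.
From mathcomp Require Import generic_quotient boolp classical_sets functions Rstruct.
From mathcomp Require Import zify ring lra.
Require Import Defs.

Set Implicit Arguments.
Unset Strict Implicit.
Unset Printing Implicit Defensive.

Import Order.TTheory GRing.Theory Num.Theory.
Local Open Scope ring_scope.

(** * p-adic integers *)

(** At 3 and at each [p i] the four torsion images have pairwise distinct valuation parities, so the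
    valuations of (b1, b2) single out one torsion point, and what remains is that two units be
    squares modulo p. This is why the condition is a pair of equations in which the exponents of p
    multiply Legendre symbols. At [p i] the points (n, 1) and (-3, -n) have parities (1, 0) and (0,
    1); at 3 the parity (0, 1) belongs to (-3n, -n) instead, since -3n has valuation 2 there, and so
    3 gets lemmas of its own. At 2 the torsion images do not suffice, and a test of all classes
    shows that the soluble ones are cut out by linear equations. These depend on n modulo 8: the
    cases n = 1, n = 5 and n = 3 or 7 are the three matrices, nt being 3n modulo 8. The Selmer group
    ranges over rational pairs: they are replaced by signed squarefree integers, whose prime factors
    are restricted by solubility at the primes of good reduction. *)

(** This is [covering_has_point] for the roots 0, n and -3n, with coefficients in K itself, so that
    they can be moved within square classes of K. *)
Definition cov (K : fieldType) (n b1 b2 : K) : Prop :=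
  exists z0 z1 z2 z3 : K,
    [/\ ~~ [&& z0 == 0, z1 == 0, z2 == 0 & z3 == 0],
        b1 * z1 ^+ 2 - b2 * z2 ^+ 2 = n * z0 ^+ 2
      & b1 * z1 ^+ 2 - b1 * b2 * z3 ^+ 2 = - (3 * n) * z0 ^+ 2].

Definition is_square (K : fieldType) (a : K) := exists z, z ^+ 2 = a.

Lemma frac_numden (R : idomainType) (x : {fraction R}) :
  exists a d : R, d != 0 /\ FracField.tofrac d * x = FracField.tofrac a.
Proof.
elim/quotW: x => r; exists (frac r).1, (frac r).2; split.
  exact: denom_ratioP.
unlock FracField.tofrac; rewrite -[LHS]FracField.pi_mul.
apply/eqmodP; rewrite /= FracField.equivfE /FracField.mulf.
rewrite !numden_Ratio ?mulf_neq0 ?oner_eq0 ?mul1r ?mulr1 ?denom_ratioP //.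
Qed.

Section Padic.
Variable p : prime_nat.
Local Notation q k := (Posz (p ^ k)%N).
Implicit Types x y z : Zp p.

Lemma residue_intr (m : int) k : (m%:~R : Zp p) k = (m %% q k)%Z.
Proof.
have natE (j : nat) : (j%:R : Zp p) = intZp p j.
  elim: j => [|j IHj]; first by apply: Zp_eqP.
  rewrite -natr1 IHj; apply: Zp_eqP => i /=.
  by rewrite modzDm -PoszD addn1.
case: (intP m) => [|j|j] //.
- by rewrite -pmulrn natE.
- by rewrite mulrNz -pmulrn natE /= modzNm.
Qed.

(** At level j the cofactor is the quotient of [x (k + j)] by [p ^ k]: the shift of the index makes
    up for the k digits lost in the division. *)
Lemma Zp_mulpE k (x : Zp p) : x k = 0 -> exists y, x = (q k)%:~R * y.
Proof.
move=> xk0.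
have dv j : (q k %| x (k + j)%N)%Z.
  by apply/dvdz_mod0P; rewrite residue_add residue_mod.
have coh j : ((x (k + j.+1)%N %/ q k)%Z = (x (k + j)%N %/ q k)%Z %[mod q j])%Z.
  apply/eqP; rewrite eqz_mod_dvd -(@dvdz_mul2l (q k)) ?q_neq0 //.
  rewrite mulrBr ![q k * (_ %/ _)%Z]mulrC !divzK // -PoszM -expnD.
  by rewrite -eqz_mod_dvd addnS (residueS x (k + j)) modz_mod.
exists (coherent coh); apply: Zp_eqP => j.
rewrite -[_ * _]/(mulZp _ _) /mulZp /= residue_intr -[LHS]residue_mod.
by rewrite modzMm mulrC divzK // addnC residue_add.
Qed.

Lemma tofrac_int (m : int) : FracField.tofrac (m%:~R : Zp p) = m%:~R.
Proof. by rewrite rmorph_int. Qed.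

(** A relation with any representative [m], reduced or not, so that polynomial expressions in
    residues can be followed without reducing them. *)
Definition residue_is k x (m : int) := x k = (m %% q k)%Z.

Lemma residue_is_self k x : residue_is k x (x k).
Proof. by rewrite /residue_is residue_mod. Qed.

Lemma residue_is_int k (m : int) : residue_is k m%:~R m.
Proof. exact: residue_intr. Qed.

Lemma residue_isD k x y (a b : int) :
  residue_is k x a -> residue_is k y b -> residue_is k (x + y) (a + b).
Proof. by rewrite /residue_is /= => -> ->; rewrite modzDm. Qed.

Lemma residue_isB k x y (a b : int) :
  residue_is k x a -> residue_is k y b -> residue_is k (x - y) (a - b).
Proof. by rewrite /residue_is /= => -> ->; rewrite modzNm modzDm. Qed.

Lemma residue_isM k x y (a b : int) :
  residue_is k x a -> residue_is k y b -> residue_is k (x * y) (a * b).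
Proof. by rewrite /residue_is /= => -> ->; rewrite modzMm. Qed.

Lemma residue_isX k x (a : int) j :
  residue_is k x a -> residue_is k (x ^+ j) (a ^+ j).
Proof.
move=> xa; elim: j => [|j IHj]; first exact: (residue_is_int k 1).
by rewrite !exprS; apply: residue_isM.
Qed.

Lemma residue_is0 k (a : int) : residue_is k 0 a -> (q k %| a)%Z.
Proof. by rewrite /residue_is /= mod0z => e; apply/dvdz_mod0P. Qed.

(** The first level at which some coordinate is nonzero is of the form e + 1, since level 0 is
    always zero; all coordinates vanish at level e and are divided by [p ^ e]. *)
Lemma primitive_vector (I : finType) (w : I -> Zp p) :
  (exists i, w i != 0) ->
  exists e (u : I -> Zp p),
    (forall i, w i = (q e)%:~R * u i) /\ exists i, u i 1%N != 0.
Proof.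
case=> i0 wi0.
pose P k := [exists i, w i k != 0].
have exP : exists k, P k.
  have [k hk] := residue_neq0 wi0; exists k; apply/existsP; exists i0.
  by apply: contraNneq (hk 0%N) => E; rewrite addn0 E dvdz0.
case: (ex_minnP exP) => -[|e] Pe mine.
  case/existsP: Pe => i; rewrite -residue_mod expn0 modz1 eqxx //.
have we i : w i e = 0.
  by apply/eqP/negPn/negP => h; have := mine e (introT existsP (ex_intro _ i h)); rewrite ltnn.
have [u hu] := choice (fun i => Zp_mulpE (we i)).
exists e, u; split=> //; case/existsP: Pe => i wi; exists i.
apply: contraNneq wi => u1; rewrite hu.
rewrite -[_ * _]/(mulZp _ _) /mulZp /= residue_intr modzMml.
apply/eqP/dvdz_mod0P; rewrite -addn1 expnD PoszM dvdz_mul //.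
have /dvdz_mod0P : (u i (1 + e)%N %% q 1 = 0)%Z.
  by rewrite residue_add residue_mod u1.
by rewrite addnC.
Qed.

(** The equations are homogeneous, so a point can be scaled to a primitive vector over [Zp p]; its
    residues at level k are the required integers. *)
Lemma cov_residues (n b1 b2 : int) k : (0 < k)%N ->
  cov (n%:~R : Qp p) b1%:~R b2%:~R ->
  exists z0 z1 z2 z3 : int,
    [/\ ~~ [&& (p %| z0)%Z, (p %| z1)%Z, (p %| z2)%Z & (p %| z3)%Z],
        (q k %| b1 * z1 ^+ 2 - b2 * z2 ^+ 2 - n * z0 ^+ 2)%Z
      & (q k %| b1 * z1 ^+ 2 - b1 * b2 * z3 ^+ 2 + 3 * n * z0 ^+ 2)%Z].
Proof.
move=> k_gt0 [z0 [z1 [z2 [z3 [nz e1 e2]]]]].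
pose z (i : 'I_4) := [:: z0; z1; z2; z3]`_i.
have [a] := choice (fun i => frac_numden (z i)).
move=> /choice[d hd].
pose D := \prod_i d i; pose w i := a i * \prod_(j | j != i) d j.
have Dn0 : D != 0 by apply/prodf_neq0 => i _; case: (hd i).
have wE i : FracField.tofrac (w i) = FracField.tofrac D * z i.
  rewrite /w tofracM -(hd i).2 mulrAC -tofracM; congr (FracField.tofrac _ * _).
  by rewrite /D [RHS](bigD1 i).
have wn0 : exists i, w i != 0.
  apply: contrapT => /forallNP w0; case/negP: nz.
  have z00 i : z i == 0.
    have /negP := w0 i; rewrite negbK => /eqP wi.
    have /eqP := wE i; rewrite wi tofrac0 eq_sym mulf_eq0 tofrac_eq0.
    by rewrite (negPf Dn0).
  have := (z00 0, z00 1, z00 2%:R, z00 3%:R) => -[[[/= -> ->] ->] ->] //.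
have [e [u [uE [i0 ui0]]]] := primitive_vector wn0.
have qe : (q e)%:~R != 0 :> Zp p.
  apply/eqP => /(congr1 (fun x : Zp p => x e.+1)); rewrite residue_intr /=.
  rewrite mod0z => /dvdz_mod0P; rewrite dvdzE /= dvdn_Pexp2l ?ltnn //.
  exact: prime_gt1 (primeP p).
(* A single scalar takes the given point to the primitive vector, so both quadratic equations are
   multiplied by [c ^+ 2]. *)
pose c := FracField.tofrac D / FracField.tofrac ((q e)%:~R : Zp p).
have uz i : FracField.tofrac (u i) = c * z i.
  rewrite /c mulrAC -wE uE tofracM mulrAC divff ?mul1r //.
  by rewrite tofrac_eq0.
have f1 : b1%:~R * u 1 ^+ 2 - b2%:~R * u 2%:R ^+ 2 - n%:~R * u 0 ^+ 2 = 0.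
  apply/eqP; rewrite -tofrac_eq0 !tofracB !(tofracXn, tofracM) !tofrac_int !uz.
  apply/eqP; transitivity (c ^+ 2 * (b1%:~R * z1 ^+ 2 - b2%:~R * z2 ^+ 2 - n%:~R * z0 ^+ 2)).
    by rewrite /z /=; ring.
  by rewrite e1 subrr mulr0.
have f2 : b1%:~R * u 1 ^+ 2 - (b1 * b2)%:~R * u 3%:R ^+ 2 + (3 * n)%:~R * u 0 ^+ 2 = 0.
  apply/eqP; rewrite -tofrac_eq0 !tofracD !tofracN !(tofracXn, tofracM) !tofrac_int !uz.
  apply/eqP; transitivity (c ^+ 2 *
    (b1%:~R * z1 ^+ 2 - b1%:~R * b2%:~R * z3 ^+ 2 + 3 * n%:~R * z0 ^+ 2)).
    by rewrite /z /=; ring.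
  by rewrite e2 mulNr addNr mulr0.
exists (u 0 k), (u 1 k), (u 2%:R k), (u 3%:R k); split.
- have uk i : (p %| u i k)%Z -> u i 1%N == 0.
    move=> /dvdz_mod0P pu; have := residue_add (u i) 1 k.-1.
    by rewrite residue_mod expn1 add1n prednK // pu => <-.
  apply/negP => /and4P[/uk h0 /uk h1 /uk h2 /uk h3]; case/negP: ui0.
  by case: i0 => -[|[|[|[|//]]]] hi;
    [have -> : Ordinal hi = 0 by exact/val_inj
    | have -> : Ordinal hi = 1 by exact/val_inj
    | have -> : Ordinal hi = 2%:R by exact/val_inj
    | have -> : Ordinal hi = 3%:R by exact/val_inj].
- have sq i : residue_is k (u i ^+ 2) (u i k ^+ 2).
    exact: residue_isX (residue_is_self _ _).
  apply: residue_is0; rewrite -f1.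
  apply: residue_isB; last exact: residue_isM (residue_is_int _ _) (sq _).
  by apply: residue_isB; exact: residue_isM (residue_is_int _ _) (sq _).
- have sq i : residue_is k (u i ^+ 2) (u i k ^+ 2).
    exact: residue_isX (residue_is_self _ _).
  apply: residue_is0; rewrite -f2.
  apply: residue_isD; last exact: residue_isM (residue_is_int _ _) (sq _).
  by apply: residue_isB; exact: residue_isM (residue_is_int _ _) (sq _).
Qed.

(* Newton iteration with the constant slope [c]: if [g = f u] then
   [f (u - c g) = g (1 - c (2 u + b) + c^2 g)]. *)
Lemma hensel_monic_quadratic (b c u0 d : int) :
  (p %| u0 ^+ 2 + b * u0 + d)%Z -> (p %| 1 - c * (2 * u0 + b))%Z ->
  exists z : Zp p, z ^+ 2 + b%:~R * z + d%:~R = 0.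
Proof.
set f := fun u : int => u ^+ 2 + b * u + d.
move=> fu0 cu0; pose s k := iter k (fun u => u - c * f u) u0.
have sP k : (q k.+1 %| f (s k))%Z /\ (p %| s k - u0)%Z.
  elim: k => [|k [IH1 IH2]]; first by rewrite expn1 /= subrr dvdz0.
  have fE : f (s k.+1) = f (s k) * (1 - c * (2 * s k + b) + c ^+ 2 * f (s k)).
    by rewrite /= /f; ring.
  have pf : (p %| f (s k))%Z by apply: dvdz_trans IH1; rewrite dvdzE /= dvdn_exp.
  split.
    (* Since [s k] stays congruent to [u0], [c] stays an inverse of the derivative modulo p, and
       each iteration gains a factor p. *)
    rewrite fE expnSr PoszM dvdz_mul // rpredD ?dvdz_mull //.
    have -> : 1 - c * (2 * s k + b) = 1 - c * (2 * u0 + b) - c * 2 * (s k - u0) by ring.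
    by rewrite rpredB // dvdz_mull.
  have -> : s k.+1 - u0 = (s k - u0) - c * f (s k) by rewrite /=; ring.
  by rewrite rpredB // dvdz_mull.
have coh k : (s k.+1 = s k %[mod q k])%Z.
  apply/eqP; rewrite eqz_mod_dvd.
  have -> : s k.+1 - s k = - (c * f (s k)) by rewrite /=; ring.
  rewrite rpredN dvdz_mull //; apply: dvdz_trans (sP k).1.
  by rewrite dvdzE /= dvdn_exp2l.
exists (coherent coh); apply: Zp_eqP => k.
have -> : (0 : Zp p) k = 0 by rewrite /= mod0z.
have -> : (coherent coh ^+ 2 + b%:~R * coherent coh + d%:~R) k = (f (s k) %% q k)%Z.
  rewrite -/(residue_is k _ _).
  by do ?[apply: residue_isD | apply: residue_isM | apply: residue_isX
    | exact: residue_is_int].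
by apply/dvdz_mod0P; apply: dvdz_trans (sP k).1; rewrite dvdzE /= dvdn_exp2l.
Qed.

Lemma is_square_Qp_odd (m x : int) : odd p -> ~~ (p %| m)%Z ->
  (p %| x ^+ 2 - m)%Z -> is_square (m%:~R : Qp p).
Proof.
move=> p_odd pm px.
have cop : coprimez (2 * x) p.
  rewrite coprimezE abszM coprimeMl coprime_sym coprimen2 p_odd /=.
  rewrite coprime_sym prime_coprime ?primeP //.
  apply: contra pm => px'.
  have -> : m = x * x - (x ^+ 2 - m) by ring.
  by rewrite rpredB // dvdz_mulr.
(* The Bezout coefficient [c] inverts the derivative 2x modulo p: it is the slope of the Newton
   iteration. *)
have [[c d] /= cd] : exists cd : int * int, cd.1 * (2 * x) + cd.2 * p = 1.
  by case/coprimezP: cop => -[c d] /= h; exists (c, d).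
have [||z hz] := @hensel_monic_quadratic 0 c x (- m).
- by rewrite mul0r addr0.
- have -> : 1 - c * (2 * x + 0) = d * p by rewrite -[X in X - _]cd; ring.
  by rewrite dvdz_mull.
exists (FracField.tofrac z).
rewrite -tofracXn -tofrac_int; apply/eqP; rewrite tofrac_eq -subr_eq0 -hz.
by rewrite mul0r addr0 rmorphN.
Qed.

End Padic.

(** The derivative of X^2 - m is even. For m = 8a + 1 the root is sought as 1 + 2z, which turns the
    equation into z^2 + z - 2a = 0, whose derivative 2z + 1 is odd. *)
Lemma is_square_Q2 (p : prime_nat) (m : int) : p = 2 :> nat ->
  (8 %| m - 1)%Z -> is_square (m%:~R : Qp p).
Proof.
move=> p2 /dvdzP[a ma].
have [||z hz] := @hensel_monic_quadratic p 1 1 0 (- (2 * a)).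
- by rewrite p2 expr0n mulr0 !add0r rpredN dvdz_mulr.
- by rewrite p2 mulr0 add0r mul1r subrr dvdz0.
exists (FracField.tofrac (1 + 2 * z)).
rewrite -tofracXn -tofrac_int; apply/eqP; rewrite tofrac_eq -subr_eq0.
have -> : m = 8 * a + 1 by lia.
have -> : (1 + 2 * z) ^+ 2 - (8 * a + 1)%:~R = 4 * (z ^+ 2 + 1%:~R * z + (- (2 * a))%:~R) by ring.
by rewrite hz mulr0.
Qed.

(** If two integers at distance d > 0 had the same image, then p^d would divide d, although d <
    p^d. *)
Lemma intr_Qp_inj (p : prime_nat) : injective (intr : int -> Qp p).
Proof.
move=> m l /eqP; rewrite -!tofrac_int tofrac_eq => /eqP ml.
apply/eqP; rewrite -subr_eq0 -absz_eq0 -leqn0 leqNgt; apply/negP => gt0.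
have /dvdn_leq : (p ^ `|(m - l)%R| %| `|(m - l)%R|)%N.
  rewrite -[(_ %| _)%N]/((p ^ `|(m - l)%R|)%N%:Z %| (m - l)%R)%Z.
  rewrite -eqz_mod_dvd; apply/eqP; rewrite -!residue_intr.
  by rewrite ml.
by move/(_ gt0); rewrite leqNgt ltn_expl // prime_gt1 // primeP.
Qed.

(** * The quadratic character of a finite field *)

Definition chi (F : finFieldType) (x : F) : int :=
  if x == 0 then 0 else if [exists y, y ^+ 2 == x] then 1 else -1.

Section QuadraticCharacter.
Variable F : finFieldType.
Hypothesis F_odd : odd #|F|.
Implicit Types x y : F.

Lemma finField_card_gt1 : (1 < #|F|)%N.
Proof. exact: finNzRing_gt1. Qed.

Lemma expf_card_pred x : x != 0 -> x ^+ #|F|.-1 = 1.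
Proof.
move=> x0; apply: (mulfI x0); rewrite -exprS prednK ?expf_card ?mulr1 //.
exact: ltnW finField_card_gt1.
Qed.

Lemma finField_prim_root : exists z : F, #|F|.-1.-primitive_root z.
Proof.
pose rs := [seq x <- enum F | x != 0].
have /hasP[z _ hz] : has #|F|.-1.-primitive_root rs.
  apply: has_prim_root; first by have := finField_card_gt1; lia.
  - apply/allP => x; rewrite mem_filter unity_rootE => /andP[x0 _].
    by rewrite expf_card_pred.
  - by rewrite filter_uniq // enum_uniq.
  - have := count_predC (pred1 (0 : F)) (enum F).
    rewrite count_uniq_mem ?enum_uniq // mem_enum -cardE size_filter.
    by move=> <-; rewrite inE.
by exists z.
Qed.

Let m := #|F|.-1./2.

Lemma finField_card_pred : #|F|.-1 = m.*2.
Proof. by rewrite /m; have := finField_card_gt1; have := odd_double_half #|F|.-1; lia. Qed.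

Lemma half_card_gt0 : (0 < m)%N.
Proof. by have := finField_card_gt1; have := finField_card_pred; lia. Qed.

Lemma exp_half_sqr x : x != 0 -> (x ^+ m) ^+ 2 = 1.
Proof. by move=> x0; rewrite -exprM muln2 -finField_card_pred expf_card_pred. Qed.

Lemma finField_prim_root_neq0 (z : F) : #|F|.-1.-primitive_root z -> z != 0.
Proof.
move=> hz; apply/eqP => E; have /eqP := prim_expr_order hz.
by rewrite E expr0n finField_card_pred double_eq0 eqn0Ngt half_card_gt0 /= eq_sym oner_eq0.
Qed.

Lemma prim_root_exp_half (z : F) : #|F|.-1.-primitive_root z -> z ^+ m != 1.
Proof.
move=> hz; rewrite -(prim_order_dvd hz) finField_card_pred; apply/negP.
by move=> /(dvdn_leq half_card_gt0); have := half_card_gt0; lia.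
Qed.

(** For a primitive root z, the element z^m has square 1 without being 1; it is therefore -1, and 1
    differs from -1. *)
Lemma finField_2neq0 : (2 : F) != 0.
Proof.
have [z hz] := finField_prim_root.
have zm := prim_root_exp_half hz.
have z0 := finField_prim_root_neq0 hz.
have /eqP := exp_half_sqr z0; rewrite sqrf_eq1 (negPf zm) /= => /eqP E.
by apply: contra zm => /eqP two; rewrite E -subr_eq0 -opprD -[1 + 1]/2 two oppr0.
Qed.

(** Euler's criterion. If x^m = 1 and x = z^k for a primitive root z, then 2m divides km, so k is
    even and x is a square. *)
Lemma chi_euler x : (chi x)%:~R = x ^+ m.
Proof.
rewrite /chi; case: eqP => [->|/eqP x0]; first by rewrite expr0n eqn0Ngt half_card_gt0.
case: existsP => [[y /eqP yx]|nsq].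
  move: x0; rewrite -yx => x0.
  by rewrite exprAC exp_half_sqr //; apply: contraNneq x0 => ->; rewrite expr0n.
have /eqP := exp_half_sqr x0; rewrite sqrf_eq1 => /orP[/eqP E|/eqP -> //].
case: nsq; have [z hz] := finField_prim_root.
have [[k _] /= xE] := prim_rootP hz (expf_card_pred x0).
have : (2 %| k)%N.
  rewrite -(@dvdn_pmul2r m) ?half_card_gt0 // mul2n -finField_card_pred.
  by rewrite (prim_order_dvd hz) exprM -xE E.
by move=> /dvdnP[j kE]; exists (z ^+ j); rewrite -exprM -kE xE.
Qed.

(** This lets identities between the integer values of [chi] be proved in F, where Euler's criterion
    makes [chi] a power. *)
Lemma chi_intr_inj (a b : int) : a \in [:: 0; 1; -1] -> b \in [:: 0; 1; -1] ->
  a%:~R = b%:~R :> F -> a = b.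
Proof.
have n1 : 1 != -1 :> F by rewrite -subr_eq0 opprK finField_2neq0.
have n1' : -1 != 1 :> F by rewrite eq_sym.
rewrite !inE => /or3P[]/eqP-> /or3P[]/eqP-> //;
  rewrite ?mulrNz ?mulr0z ?mulr1z => /eqP;
  by rewrite ?(eq_sym 0) ?oppr_eq0 ?oner_eq0 ?(negPf n1) ?(negPf n1').
Qed.

Lemma chi_range x : chi x \in [:: 0; 1; -1].
Proof. by rewrite /chi; case: ifP => // _; case: ifP. Qed.

Lemma chiM x y : chi (x * y) = chi x * chi y.
Proof.
apply: chi_intr_inj; first exact: chi_range.
  by have := chi_range x; have := chi_range y; rewrite !inE => /or3P[]/eqP-> /or3P[]/eqP->.
by rewrite intrM !chi_euler exprMn.
Qed.

Lemma chi0 : chi (0 : F) = 0.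
Proof. by rewrite /chi eqxx. Qed.

Lemma chi_sqr x : x != 0 -> chi x ^+ 2 = 1.
Proof. by rewrite /chi => /negPf ->; case: ifP. Qed.

Lemma chi1 : chi (1 : F) = 1.
Proof.
apply: chi_intr_inj; rewrite ?chi_range // chi_euler expr1n //.
Qed.

(** A primitive root is not a square, so multiplication by it permutes F and changes the sign of
    every term. *)
Lemma sum_chi : \sum_(x : F) chi x = 0.
Proof.
have [z hz] := finField_prim_root.
have zm := prim_root_exp_half hz.
have z0 := finField_prim_root_neq0 hz.
have chiz : chi z = -1.
  have : chi z != 1 by apply: contra zm => /eqP E; rewrite -chi_euler E.
  by have := chi_sqr z0; have := chi_range z; rewrite !inE => /or3P[]/eqP->.
have : \sum_(x : F) chi x = - \sum_(x : F) chi x.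
  rewrite [LHS](reindex_inj (mulfI z0)) -sumrN; apply: eq_bigr => x _.
  by rewrite chiM chiz mulN1r.
by lia.
Qed.

Lemma sum_chi_affine (b c : F) : b != 0 -> \sum_x chi (b * (x - c)) = 0.
Proof.
move=> b0; rewrite -{2}sum_chi [RHS](reindex_inj (h := fun x => b * (x - c))) //.
by move=> x y /(mulfI b0) /addIr.
Qed.

Lemma sum_chi2 (a c : F) : a != c -> \sum_x chi (x - a) * chi (x - c) = -1.
Proof.
rewrite -subr_eq0 => ac; pose d := c - a.
have d0 : d != 0 by rewrite /d -opprB oppr_eq0.
(* The parameter u is the ratio (x - c) / (x - a), so the product of the two characters is chi(u).
   As the inverse of 0 is 0, [h 1] is [a]; this makes [h] a permutation of F, and the term at u = 1
   vanishes. *)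
pose h u := a + d / (1 - u).
have h_inj : injective h.
  by move=> u v /addrI /(mulfI d0) /invr_inj /addrI /oppr_inj.
rewrite (reindex_inj h_inj) (bigD1 1) //= /h subrr invr0 mulr0 addr0 subrr chi0 mul0r add0r.
have E u : u != 1 -> chi (a + d / (1 - u) - a) * chi (a + d / (1 - u) - c) = chi u.
  move=> u1; have v0 : 1 - u != 0 by rewrite subr_eq0 eq_sym.
  rewrite -chiM; have -> : (a + d / (1 - u) - a) * (a + d / (1 - u) - c) = (d / (1 - u)) ^+ 2 * u.
    by rewrite /d; field.
  by rewrite chiM expr2 chiM -expr2 chi_sqr ?mul1r // mulf_neq0 ?invr_eq0.
rewrite (eq_bigr _ E); have := sum_chi; rewrite (bigD1 1) //= chi1 => /eqP.
by rewrite addrC addr_eq0 => /eqP.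
Qed.

Lemma chi_not_m1 x : chi x != -1 -> exists y, y ^+ 2 = x.
Proof.
rewrite /chi; case: existsP => [[y /eqP yx] _|_]; first by exists y.
by case: (eqVneq x 0) => [-> _|//]; exists 0; rewrite expr0n.
Qed.

(* Over a field with [q] elements, unless [b1] and [b2] are both squares, the
   character sum [T] below equals [q + 1 + S] with [S] the character sum of
   [x (x - n) (x + 3 n)], and trivially [S >= 1 - q]. *)
Lemma finField_two_cover (n b1 b2 : F) :
  3 != 0 :> F -> n != 0 -> b1 != 0 -> b2 != 0 -> (chi b1 != 1) || (chi b2 != 1) ->
  exists x, [/\ chi (b1 * x) != -1, chi (b2 * (x - n)) != -1
              & chi (b1 * b2 * (x + 3 * n)) != -1].
Proof.
move=> three n0 b10 b20 nb.
pose P x := [&& chi (b1 * x) != -1, chi (b2 * (x - n)) != -1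
              & chi (b1 * b2 * (x + 3 * n)) != -1].
case: (pickP P) => [x /and3P[]|noP]; first by exists x.
pose T := \sum_x (1 + chi (b1 * x)) * (1 + chi (b2 * (x - n)))
                  * (1 + chi (b1 * b2 * (x + 3 * n))).
have T0 : T = 0.
  apply: big1 => x _; have /negbT := noP x; rewrite /P !negb_and !negbK.
  by case/or3P=> /eqP->; rewrite subrr ?mulr0 ?mul0r.
pose t x := chi x * chi (x - n) * chi (x + 3 * n).
have c0 x : chi x = chi (x - 0) by rewrite subr0.
have c3 x : chi (x + 3 * n) = chi (x - (- 3 * n)) by rewrite mulNr opprK.
have S0 : \sum_x chi x * chi (x - n) = -1.
  by under eq_bigr do rewrite c0; rewrite sum_chi2 // eq_sym.
have S1 : \sum_x chi x * chi (x + 3 * n) = -1.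
  under eq_bigr do rewrite c0 c3; rewrite sum_chi2 //.
  by rewrite eq_sym mulf_neq0 // oppr_eq0.
have S2 : \sum_x chi (x - n) * chi (x + 3 * n) = -1.
  under eq_bigr do rewrite c3; rewrite sum_chi2 //.
  rewrite -subr_eq0; have -> : n - - 3 * n = 2 * 2 * n by ring.
  by rewrite !mulf_neq0 ?finField_2neq0.
have L1 : \sum_x chi (b1 * x) = 0.
  by rewrite -[RHS](sum_chi_affine 0 b10); apply: eq_bigr => x _; rewrite subr0.
have L2 := sum_chi_affine n b20.
have L3 : \sum_x chi (b1 * b2 * (x + 3 * n)) = 0.
  under eq_bigr do rewrite -[_ * n]opprK -mulNr.
  by rewrite sum_chi_affine // mulf_neq0.
have e1 := chi_sqr b10; have e2 := chi_sqr b20.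
(* The three signs multiply to a square, so the cubic term [X * Y * W] has coefficient 1 whatever b1
   and b2 are. *)
have alg (a b X Y W : int) : a ^+ 2 = 1 -> b ^+ 2 = 1 ->
    (1 + a * X) * (1 + b * Y) * (1 + a * b * W)
    = 1 + a * X + b * Y + a * b * W + a * b * (X * Y) + b * (X * W) + a * (Y * W)
      + X * Y * W.
  move=> ha hb.
  transitivity (1 + a * X + b * Y + a * b * W + a * b * (X * Y) + a ^+ 2 * b * (X * W)
    + a * b ^+ 2 * (Y * W) + a ^+ 2 * b ^+ 2 * (X * Y * W)); first by ring.
  by rewrite ha hb; ring.
have TE : T = #|F|%:Z - chi b1 * chi b2 - chi b2 - chi b1 + \sum_x t x.
  rewrite /T; transitivity (\sum_x (1 + chi (b1 * x) + chi (b2 * (x - n))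
    + chi (b1 * b2 * (x + 3 * n)) + chi b1 * chi b2 * (chi x * chi (x - n))
    + chi b2 * (chi x * chi (x + 3 * n)) + chi b1 * (chi (x - n) * chi (x + 3 * n))
    + t x)).
    by apply: eq_bigr => x _; rewrite !chiM /t; exact: alg.
  rewrite !big_split /= -!mulr_sumr S0 S1 S2 L1 L2 L3 sumr_const.
  by rewrite !addr0 !mulrN1 natz.
(* The term at x = 0 vanishes and every other term is at least -1. *)
have S3 : \sum_x t x >= 1 - #|F|%:Z.
  rewrite (bigD1 0) //= {1}/t chi0 !mul0r add0r.
  have -> : 1 - #|F|%:Z = \sum_(x : F | x != 0) (-1).
    rewrite sumr_const cardC1 mulNrn natz; have := finField_card_gt1.
  by case: #|F| => // k _; rewrite -addn1 PoszD /=; lia.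
  apply: ler_sum => x _; rewrite /t.
  have := chi_range (x + 3 * n); have := chi_range (x - n); have := chi_range x.
  by rewrite !inE => /or3P[]/eqP-> /or3P[]/eqP-> /or3P[]/eqP->.
(* One of the two signs is -1, so (1 + chi b1) (1 + chi b2) = 0. Hence T is at least 2, against
   [T0]. *)
have : chi b1 * chi b2 + chi b1 + chi b2 = -1.
  have h2 : chi b2 = 1 \/ chi b2 = -1 by move: e2; clear; nia.
  have h1 : chi b1 = 1 \/ chi b1 = -1 by move: e1; clear; nia.
  by case: h1 h2 nb => -> [] ->.
by move: T0 TE S3; clear; lia.
Qed.

End QuadraticCharacter.

(** * Additive Legendre symbols *)

Lemma F2P (x : 'F_2) : x = 0 \/ x = 1.
Proof. by case: x => -[|[|//]] i; [left|right]; apply/val_inj. Qed.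

Section AddLegendre.
Variable l : nat.
Hypotheses (l_prime : prime l) (l_odd : odd l).
Implicit Types a b : int.

Let F_odd : odd #|'F_l|. Proof. by rewrite card_Fp. Qed.

Lemma intr_Fp_eq0 a : (a%:~R == 0 :> 'F_l) = (l %| a)%Z.
Proof. by rewrite (dvdz_pcharf (pchar_Fp l_prime)). Qed.

Lemma intr_Fp_eq a b : (a%:~R == b%:~R :> 'F_l) = (l %| a - b)%Z.
Proof. by rewrite -subr_eq0 -rmorphB intr_Fp_eq0. Qed.

Lemma Fp_intr (x : 'F_l) : exists a : int, x = a%:~R.
Proof. by exists (x : nat); rewrite -pmulrn natr_Zp. Qed.

Lemma legendre_chi a : legendre a l = chi (a%:~R : 'F_l).
Proof.
rewrite /legendre /chi intr_Fp_eq0; case: ifP => // _.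
congr (if _ then _ else _); apply/existsP/existsP => -[x /eqP xa].
  exists (x : nat)%:R; move: xa => /eqP; rewrite eqz_mod_dvd -intr_Fp_eq.
  by rewrite rmorphXn /= -pmulrn.
have ltx : ((x : nat) < l)%N by rewrite -[X in (_ < X)%N](Fp_cast l_prime) ltn_ord.
exists (Ordinal ltx) => /=; rewrite eqz_mod_dvd -intr_Fp_eq rmorphXn /= -pmulrn natr_Zp.
by rewrite xa.
Qed.

Lemma add_legendreE a : add_legendre a l = (chi (a%:~R : 'F_l) == -1)%:R.
Proof.
rewrite /add_legendre legendre_chi.
by have := chi_range (a%:~R : 'F_l); rewrite !inE => /or3P[]/eqP->; apply/eqP.
Qed.

Lemma add_legendre_congr a b : (l %| a - b)%Z -> add_legendre a l = add_legendre b l.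
Proof. by rewrite -intr_Fp_eq !add_legendreE => /eqP ->. Qed.

Lemma add_legendreM a b : ~~ (l %| a)%Z -> ~~ (l %| b)%Z ->
  add_legendre (a * b) l = add_legendre a l + add_legendre b l.
Proof.
rewrite -!intr_Fp_eq0 !add_legendreE rmorphM chiM // => /chi_sqr ha /chi_sqr hb.
move: ha hb; have := chi_range (b%:~R : 'F_l); have := chi_range (a%:~R : 'F_l).
by rewrite !inE => /or3P[]/eqP-> /or3P[]/eqP-> // _ _; apply/eqP.
Qed.

Lemma add_legendre_eq0P a : ~~ (l %| a)%Z ->
  add_legendre a l = 0 <-> exists x : int, (l %| x ^+ 2 - a)%Z.
Proof.
move=> la; rewrite add_legendreE; split.
  case: eqP => [_ /eqP //|/eqP h _]; have [y hy] := chi_not_m1 h.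
  by have [x xy] := Fp_intr y; exists x; rewrite -intr_Fp_eq rmorphXn /= -xy hy.
case=> x; rewrite -intr_Fp_eq rmorphXn /= => /eqP xa.
have x0 : x%:~R != 0 :> 'F_l.
  by apply: contra la => /eqP x0; rewrite -intr_Fp_eq0 -xa x0 expr0n.
by rewrite -xa expr2 chiM // -expr2 chi_sqr.
Qed.

Lemma add_legendre_square a : ~~ (l %| a)%Z -> add_legendre (a ^+ 2) l = 0.
Proof.
move=> la; rewrite expr2 add_legendreM //; move: (add_legendre a l).
by case=> -[|[|//]] ?; apply/eqP.
Qed.

Lemma add_legendreN1 : add_legendre (-1) l = (l %% 4 == 3)%N%:R.
Proof.
rewrite add_legendreE; congr (nat_of_bool _)%:R.
have := chi_euler F_odd (-1); rewrite card_Fp // -signr_odd => E.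
have : chi ((-1)%:~R : 'F_l) = (-1) ^+ odd l.-1./2.
  apply: (chi_intr_inj F_odd); rewrite ?chi_range //.
    by case: odd.
  by rewrite mulrNz E rmorphXn /= rmorphN1.
move=> ->; have -> : odd l.-1./2 = (l %% 4 == 3)%N by lia.
by case: (_ == 3)%N.
Qed.

(** The sum m (m + 1) / 2 is the exponent of -1 that Gauss's lemma produces below. *)
Lemma odd_triangular m : odd (\sum_(k < m) k.+1) = (m %% 4 \in [:: 1; 2])%N.
Proof.
elim: m => [|m IHm]; first by rewrite big_ord0.
rewrite big_ord_recr /= oddD IHm !inE; lia.
Qed.

(* Gauss's lemma for 2: modulo [l], the even numbers below [l] are the
   [(-1)^k k] with [1 <= k <= (l - 1) / 2]. *)
Lemma add_legendre2 : add_legendre 2 l = (l %% 8 \in [:: 3; 5])%N%:R.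
Proof.
pose m := l.-1./2.
have lm : l = m.*2.+1 by rewrite /m; have := odd_double_half l; lia.
(* The permutation [h] sends the index of (-1)^k k to half of the even number congruent to it;
   indices start at 0, numbers at 1, hence the shifts. *)
have hP (k : 'I_m) : ((if odd k.+1 then (l - k.+1)./2 else k.+1./2).-1 < m)%N.
  by have := ltn_ord k; case: ifP; lia.
pose h k := Ordinal (hP k).
have h_inj : injective h.
  move=> [a la] [b lb] /(congr1 val) /= E; apply/val_inj; rewrite /=.
  by move: E; case: ifP; case: ifP; lia.
have key : \prod_(k < m) (2 * (k.+1)%:R) = \prod_(k < m) ((-1) ^+ k.+1 * (k.+1)%:R) :> 'F_l.
  rewrite (reindex_inj h_inj); apply: eq_bigr => k _.
  have hk : ((h k).+1.*2 = if odd k.+1 then l - k.+1 else k.+1)%N.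
    by rewrite /=; have := ltn_ord k; case: ifP; lia.
  rewrite -natrM mul2n hk -signr_odd; case: ifP => _; last by rewrite mul1r.
  rewrite natrB; last by have := ltn_ord k; lia.
  by rewrite (pcharf0 (pchar_Fp l_prime)) sub0r mulN1r.
move: key; rewrite !big_split /= prodr_const card_ord prodrXr -signr_odd => key.
have fn0 : \prod_(i < m) (i.+1)%:R != 0 :> 'F_l.
  apply/prodf_neq0 => i _; rewrite pmulrn intr_Fp_eq0 dvdzE /=.
  by apply/negP => /dvdn_leq; have := ltn_ord i; lia.
move/(mulIf fn0): key => key.
rewrite add_legendreE; congr (nat_of_bool _)%:R.
have := chi_euler F_odd 2; rewrite card_Fp // -/m key odd_triangular => E.
have : chi ((2 : int)%:~R : 'F_l) = (-1) ^+ (m %% 4 \in [:: 1; 2])%N.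
  apply: (chi_intr_inj F_odd); rewrite ?chi_range //.
    by case: ((m %% 4)%N \in _).
  by rewrite E rmorphXn /= rmorphN1.
move=> ->; have -> : (l %% 8 \in [:: 3; 5])%N = (m %% 4 \in [:: 1; 2])%N.
  by rewrite !inE; lia.
by case: ((m %% 4)%N \in _).
Qed.

(* [-3] is a square iff there is a primitive cube root of unity. *)
Lemma add_legendreN3 : l != 3%N -> add_legendre (-3) l = (l %% 3 == 2)%N%:R.
Proof.
move=> l3; have l1 := prime_gt1 l_prime.
have n3 : ~~ (l %| -3)%Z by rewrite dvdzE /= dvdn_prime2.
have l3' : (l %% 3 != 0)%N.
  by apply/negP => h3; move: l3; rewrite eq_sym -(dvdn_prime2 (isT : prime 3) l_prime) /dvdn h3.
have three : (3 : 'F_l) != 0.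
  by rewrite -oppr_eq0 -[- 3]/((-3)%:~R) intr_Fp_eq0.
have two := finField_2neq0 F_odd.
have [z hz] := finField_prim_root F_odd; rewrite card_Fp // in hz.
case: eqP => [l2|l2].
  case: (F2P (add_legendre (-3) l)) => // /(add_legendre_eq0P n3)[s].
  rewrite -intr_Fp_eq rmorphXn => /eqP s3'; have s3 : s%:~R ^+ 2 = -3 :> 'F_l := s3'.
  pose w : 'F_l := (s%:~R - 1) / 2.
  have w3 : w ^+ 3 = 1.
    (* Here w^2 + w + 1 = (s^2 + 3) / 4. *)
    transitivity (1 + (w - 1) * ((s%:~R ^+ 2 + 3) / 2 / 2)).
      by rewrite /w; field.
    by rewrite s3 addNr !mul0r mulr0 addr0.
  have w1 : w != 1.
    apply: contra three => /eqP w1.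
    have sE : s%:~R = 2 * w + 1 by rewrite /w; field.
    have : 3 * (2 * 2) = 0 :> 'F_l.
      apply/eqP; rewrite -(addrN (-3 : 'F_l)) -{1}s3 sE w1.
      by apply/eqP; ring.
    by move=> /eqP; rewrite !mulf_eq0 (negPf two) !orbF.
  have [[k _] /= wk] : {i : 'I_l.-1 | w = z ^+ i}.
    have e := @expf_card_pred 'F_l w; rewrite card_Fp // in e.
    apply: (prim_rootP hz); apply: e.
    by apply: contraTneq w1 => w0; move: w3; rewrite w0 expr0n /= => /eqP; rewrite eq_sym oner_eq0.
  (* When l is 2 modulo 3, l - 1 is prime to 3; it divides 3k, hence k, which would make w equal to
     1. *)
  move: w3 w1; rewrite wk -exprM => /eqP; rewrite -!(prim_order_dvd hz).
  by rewrite Gauss_dvdl ?(coprime_sym _ 3) ?prime_coprime // => [->//|]; rewrite /dvdn; lia.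
apply/(add_legendre_eq0P n3).
have d3 : (3 %| l.-1)%N by rewrite /dvdn; lia.
pose w := z ^+ (l.-1 %/ 3).
have w3 : w ^+ 3 = 1 by rewrite -exprM divnK // prim_expr_order.
have w1 : w != 1.
  rewrite -(prim_order_dvd hz); apply/negP => /dvdn_leq.
  by have := divnK d3; lia.
(* The square root of -3 is 2w + 1, because (2w + 1)^2 + 3 = 4 (w^2 + w + 1). *)
have [s sE] := Fp_intr (2 * w + 1); exists s.
rewrite -intr_Fp_eq rmorphXn /= -sE -subr_eq0 -(inj_eq (mulfI (_ : w - 1 != 0))) ?subr_eq0 // mulr0.
apply/eqP; transitivity (4 * (w ^+ 3 - 1)); first by ring.
by rewrite w3 subrr mulr0.
Qed.

End AddLegendre.

(** Quadratic reciprocity for 3: both sides depend only on l modulo 3. It converts conditions modulo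
    3 into symbols at the primes [p i]. *)
Lemma add_legendre_3 l : prime l -> odd l -> l != 3%N -> add_legendre l 3 = add_legendre (-3) l.
Proof.
move=> pl ol l3; rewrite add_legendreN3 //.
have p3 : (l %% 3 != 0)%N.
  by apply/negP => h3; move: l3; rewrite eq_sym -(dvdn_prime2 (isT : prime 3) pl) /dvdn h3.
case: eqP => h.
  rewrite (@add_legendre_congr 3 isT l (-1)) ?add_legendreN1 //.
  by lia.
rewrite (@add_legendre_congr 3 isT l 1) //; last by lia.
by rewrite -[1](expr1n _ 2) add_legendre_square.
Qed.

(** * Square classes and 2-torsion points *)

Section Cov.
Variable K : fieldType.
Implicit Types n a b r s : K.

Lemma cov_square n b1 b2 s r1 r2 : s != 0 -> r1 != 0 -> r2 != 0 ->
  cov n b1 b2 -> cov (n * s ^+ 2) (b1 * r1 ^+ 2) (b2 * r2 ^+ 2).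
Proof.
move=> s0 r10 r20 [z0 [z1 [z2 [z3 [nz e1 e2]]]]].
exists (z0 / s), (z1 / r1), (z2 / r2), (z3 / (r1 * r2)); split.
- by rewrite !mulf_eq0 !invr_eq0 !mulf_eq0 (negPf s0) (negPf r10) (negPf r20) !orbF.
- rewrite !exprMn !exprVn; transitivity (b1 * z1 ^+ 2 - b2 * z2 ^+ 2).
    by field; rewrite r10 r20.
  by rewrite e1; field.
- rewrite !exprMn !exprVn; transitivity (b1 * z1 ^+ 2 - b1 * b2 * z3 ^+ 2).
    by field; rewrite r10 r20.
  by rewrite e2; field.
Qed.

Definition same_class a b := exists2 r, r != 0 & a = b * r ^+ 2.

(** The parameter n moves in its square class as well; at 2 this allows n to be replaced by its
    residue modulo 8. *)
Lemma cov_same_class n b1 b2 n' b1' b2' :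
  same_class n' n -> same_class b1' b1 -> same_class b2' b2 ->
  cov n b1 b2 -> cov n' b1' b2'.
Proof. by move=> [s s0 ->] [r1 r10 ->] [r2 r20 ->]; apply: cov_square. Qed.

Lemma same_class_refl a : same_class a a.
Proof. by exists 1; rewrite ?oner_eq0 // expr1n mulr1. Qed.

Lemma same_class_is_square a b : a != 0 -> b != 0 -> is_square (a * b) -> same_class a b.
Proof.
move=> a0 b0 [z zE]; have z0 : z != 0.
  by apply: contraTneq (mulf_neq0 a0 b0) => z0; rewrite -zE z0 expr0n eqxx.
exists (z / b); first by rewrite mulf_neq0 ?invr_eq0.
by rewrite exprMn zE exprVn; field.
Qed.

(* The images of the four 2-torsion points. *)
Lemma cov_torsion0 n : cov n 1 1.
Proof.
exists 0, 1, 1, 1; split; first by rewrite !oner_eq0 /= ?andbF.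
all: by ring.
Qed.

(** The point (0, 0), where [z1] vanishes: its first class is that of the product of the other two
    differences, (-n)(3n) = -3n^2. In the next two lemmas [z2] and [z3] vanish in the same way. *)
Lemma cov_torsion1 n : cov n (- 3) (- n).
Proof.
exists 1, 0, 1, 1; split; first by rewrite !oner_eq0 /= ?andbF.
all: by ring.
Qed.

Lemma cov_torsion2 n : cov n n 1.
Proof.
exists 1, 1, 0, 2; split; first by rewrite !oner_eq0 /= ?andbF.
all: by ring.
Qed.

Lemma cov_torsion3 n : cov n (- (3 * n)) (- n).
Proof.
exists 1, 1, 2, 0; split; first by rewrite !oner_eq0 /= ?andbF.
all: by ring.
Qed.

End Cov.

Section OddPrime.
Variable p : prime_nat.
Hypothesis p_odd : odd p.
Implicit Types a b n z : int.
Let pr : prime p := primeP p.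
Local Notation D a := (p %| a)%Z.

Lemma prime_dvdzM a b : D (a * b) = D a || D b.
Proof. by rewrite !dvdzE abszM Euclid_dvdM. Qed.

Lemma prime_dvdz2 : ~~ D 2.
Proof.
by rewrite dvdzE /= dvdn_prime2 //; apply: contraTneq p_odd => ->.
Qed.

Lemma dvdz_unit_square a z : ~~ D a -> D (a * (z * z)) -> D z.
Proof. by move=> /negPf na; rewrite !prime_dvdzM na orbb. Qed.

Lemma intr_Qp_neq0 a : a != 0 -> (a%:~R : Qp p) != 0.
Proof. by apply: contraNneq => h; apply/eqP/(@intr_Qp_inj p). Qed.

Lemma not_dvdz_neq0 a : ~~ D a -> a != 0.
Proof. by apply: contraNneq => ->; rewrite dvdz0. Qed.

(** Modulo p, ac is the square of az/w; the inverse of w comes from a Bezout relation. *)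
Lemma add_legendre_of_squares a c z w : ~~ D a -> ~~ D c -> ~~ D w ->
  D (a * (z * z) - c * (w * w)) -> add_legendre (a * c) p = 0.
Proof.
move=> na nc nw h; apply/(add_legendre_eq0P pr p_odd).
  by rewrite prime_dvdzM negb_or na.
have cop : coprimez w p.
  by rewrite coprimezE coprime_sym prime_coprime // -dvdzE.
have [[u v] /= uv] : exists uv : int * int, uv.1 * w + uv.2 * p = 1.
  by case/coprimezP: cop => -[u v] /= h'; exists (u, v).
exists (a * z * u).
have -> : (a * z * u) ^+ 2 - a * c
  = a * u * u * (a * (z * z) - c * (w * w)) + a * c * ((u * w) ^+ 2 - 1) by ring.
rewrite rpredD //; first by rewrite dvdz_mull.
have uw : u * w = 1 - v * p by rewrite -uv; ring.
rewrite dvdz_mull // uw.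
have -> : (1 - v * p%:Z) ^+ 2 - 1 = p%:Z * (- 2 * v + v * v * p%:Z) by ring.
by rewrite dvdz_mulr.
Qed.

Lemma is_square_add_legendre a : ~~ D a -> add_legendre a p = 0 ->
  is_square (a%:~R : Qp p).
Proof.
move=> na /(add_legendre_eq0P pr p_odd na)[x hx].
exact: is_square_Qp_odd hx.
Qed.

Lemma same_class_add_legendre a b : ~~ D a -> ~~ D b -> add_legendre (a * b) p = 0 ->
  same_class (a%:~R : Qp p) b%:~R.
Proof.
move=> na nb h; apply: same_class_is_square; try exact/intr_Qp_neq0/not_dvdz_neq0.
by rewrite -intrM; apply: is_square_add_legendre => //; rewrite prime_dvdzM negb_or na.
Qed.

(** The modulus is p^3 because some of the descents below cancel p twice and must still be left with
    one factor p. *)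
Lemma cov_residues3 n b1 b2 : cov (n%:~R : Qp p) b1%:~R b2%:~R ->
  exists z0 z1 z2 z3 u v : int,
    [/\ ~~ [&& D z0, D z1, D z2 & D z3],
        b1 * (z1 * z1) - b2 * (z2 * z2) - n * (z0 * z0) = p%:Z * p%:Z * p%:Z * u
      & b1 * (z1 * z1) - b1 * b2 * (z3 * z3) + 3 * n * (z0 * z0) = p%:Z * p%:Z * p%:Z * v].
Proof.
move=> /(@cov_residues p n b1 b2 3 isT)[z0 [z1 [z2 [z3 [nz]]]]].
rewrite !expnS expn0 muln1 !PoszM !mulrA => /dvdzP[u hu] /dvdzP[v hv].
by exists z0, z1, z2, z3, u, v; split; rewrite // ![p%:Z * _ * _ * _]mulrC -?hu -?hv ?expr2 ?mulrA.
Qed.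

End OddPrime.

(** * Necessary conditions at odd primes *)

Lemma subr_eq_trans (R : zmodType) (a b c d : R) : c = d -> a - b = c - d -> a = b.
Proof. by move=> -> /eqP; rewrite subrr subr_eq0 => /eqP. Qed.

(** Proves an equation that differs from [E] only by moving terms across and by a global sign. *)
Ltac lin E := first [apply: (subr_eq_trans E); ring | apply: (subr_eq_trans (esym E)); ring].

Section OddPrime.
Variable p : prime_nat.
Hypothesis p_odd : odd p.
Implicit Types a b n z : int.
Let pr : prime p := primeP p.
Local Notation D a := (p %| a)%Z.
Local Notation q := (p%:Z).

Lemma pq_neq0 : q != 0.
Proof. by rewrite eqz_nat -lt0n prime_gt0. Qed.

Lemma dvdz_eq a k : a = q * k -> D a.
Proof. by move=> ->; rewrite dvdz_mulr. Qed.

Lemma dvdz_eq2 a k : q * a = q * (q * k) -> D a.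
Proof. by move=> /(mulfI pq_neq0) ->; rewrite dvdz_mulr. Qed.

Lemma dvdz_eq3 a k : q * (q * a) = q * (q * (q * k)) -> D a.
Proof. by move=> /(mulfI pq_neq0) /(mulfI pq_neq0) ->; rewrite dvdz_mulr. Qed.

Lemma dvdz_ex a : D a -> exists b, a = q * b.
Proof. by case/dvdzP => b ->; exists b; rewrite mulrC. Qed.

Section Unramified.
Variables n b1 b2 : int.
Hypotheses (p3 : ~~ D 3) (pn : ~~ D n) (pb1 : ~~ D b1) (pb2 : ~~ D b2).

Let p3n : ~~ D (3 * n). Proof. by rewrite prime_dvdzM negb_or p3. Qed.
Let pb12 : ~~ D (b1 * b2). Proof. by rewrite prime_dvdzM negb_or pb1. Qed.

(** Modulo p only the term in [z0] survives in the second equation; the divisibility of [z0] then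
    spreads to [z2], [z1] and [z3], against primitivity. *)
Lemma not_cov_ramified1 : ~ cov (n%:~R : Qp p) (q * b1)%:~R b2%:~R.
Proof.
move=> /cov_residues3[z0 [z1 [z2 [z3 [u [v [/negP nz E1 E2]]]]]]]; apply: nz.
have d0 : D z0.
  apply: (dvdz_unit_square p3n).
  by apply: (@dvdz_eq _ (q * q * v - b1 * (z1 * z1) + b1 * b2 * (z3 * z3))); lin E2.
case/dvdz_ex: d0 (d0) => a ? ->; subst z0.
have d2 : D z2.
  apply: (dvdz_unit_square pb2).
  by apply: (@dvdz_eq _ (b1 * (z1 * z1) - n * q * (a * a) - q * q * u)); lin E1.
case/dvdz_ex: d2 (d2) => b ? ->; subst z2.
have d1 : D z1.
  apply: (dvdz_unit_square pb1).
  by apply: (@dvdz_eq2 _ (b2 * (b * b) + n * (a * a) + q * u)); lin E1.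
case/dvdz_ex: d1 (d1) => c ? ->; subst z1.
have -> // : D z3.
apply: (dvdz_unit_square pb12).
by apply: (@dvdz_eq2 _ (b1 * q * (c * c) + 3 * n * (a * a) - q * v)); lin E2.
Qed.

Lemma not_cov_ramified2 : ~~ D 2 -> ~ cov (n%:~R : Qp p) b1%:~R (q * b2)%:~R.
Proof.
move=> p2 /cov_residues3[z0 [z1 [z2 [z3 [u [v [/negP nz E1 E2]]]]]]]; apply: nz.
(* Subtracting the equations removes [z1] and leaves 4n z0^2 against multiples of p; this is where p
   must not be 2. *)
have E3 := congr2 (fun x y => x - y) E2 E1; rewrite /= in E3.
have p4n : ~~ D (2 * 2 * n) by rewrite !prime_dvdzM !negb_or p2.
have d0 : D z0.
  apply: (dvdz_unit_square p4n).
  by apply: (@dvdz_eq _ (q * q * (v - u) - b2 * (z2 * z2) + b1 * b2 * (z3 * z3))); lin E3.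
case/dvdz_ex: d0 (d0) => a ? ->; subst z0.
have d1 : D z1.
  apply: (dvdz_unit_square pb1).
  by apply: (@dvdz_eq _ (b2 * (z2 * z2) + n * q * (a * a) + q * q * u)); lin E1.
case/dvdz_ex: d1 (d1) => c ? ->; subst z1.
have d2 : D z2.
  apply: (dvdz_unit_square pb2).
  by apply: (@dvdz_eq2 _ (b1 * (c * c) - n * (a * a) - q * u)); lin E1.
rewrite d2 /=.
apply: (dvdz_unit_square pb12).
by apply: (@dvdz_eq2 _ (b1 * (c * c) + 3 * n * (a * a) - q * v)); lin E2.
Qed.

Lemma not_cov_ramified12 : ~ cov (n%:~R : Qp p) (q * b1)%:~R (q * b2)%:~R.
Proof.
move=> /cov_residues3[z0 [z1 [z2 [z3 [u [v [/negP nz E1 E2]]]]]]]; apply: nz.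
have d0 : D z0.
  apply: (dvdz_unit_square pn).
  by apply: (@dvdz_eq _ (b1 * (z1 * z1) - b2 * (z2 * z2) - q * q * u)); lin E1.
case/dvdz_ex: d0 (d0) => a ? ->; subst z0.
have d1 : D z1.
  apply: (dvdz_unit_square pb1).
  by apply: (@dvdz_eq2 _ (b1 * b2 * (z3 * z3) - 3 * n * (a * a) + q * v)); lin E2.
case/dvdz_ex: d1 (d1) => c ? ->; subst z1.
have d2 : D z2.
  apply: (dvdz_unit_square pb2).
  by apply: (@dvdz_eq2 _ (b1 * q * (c * c) - n * (a * a) - q * u)); lin E1.
case/dvdz_ex: d2 (d2) => b ? ->; subst z2.
have d0 : D a.
  apply: (dvdz_unit_square pn).
  by apply: (@dvdz_eq3 _ (b1 * (c * c) - b2 * (b * b) - u)); lin E1.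
case/dvdz_ex: d0 => e ?; subst a.
apply: (dvdz_unit_square pb12).
by apply: (@dvdz_eq3 _ (b1 * (c * c) + 3 * n * q * (e * e) - v)); lin E2.
Qed.

End Unramified.

Section Ramified.
Variables n b1 b2 : int.
Hypotheses (pn : ~~ D n) (pb1 : ~~ D b1) (pb2 : ~~ D b2).

Local Notation leg a := (add_legendre a p).

Let pb12 : ~~ D (b1 * b2). Proof. by rewrite prime_dvdzM negb_or pb1. Qed.
Let p2 : ~~ D 2 := prime_dvdz2 p_odd.
Let p1 : ~~ D 1. Proof. by rewrite dvdzE /= dvdn1; have := prime_gt1 pr; lia. Qed.
Let pNn : ~~ D (- n). Proof. by rewrite dvdzE abszN -dvdzE. Qed.

(** The two digits in the names are the valuations of the two entries at p. In each case primitivity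
    forces some coordinate to be prime to p, and the equations, divided by powers of p, then relate
    unit multiples of two squares modulo p. *)
Lemma necessary00 : cov ((q * n)%:~R : Qp p) b1%:~R b2%:~R ->
  leg b2 = 0 /\ leg (b1 * b2) = 0.
Proof.
move=> /cov_residues3[z0 [z1 [z2 [z3 [u [v [nz E1 E2]]]]]]].
have d1 : ~~ D z1.
  apply: contra nz => /[dup] d1 /dvdz_ex[c ?]; subst z1; rewrite d1.
  have d2 : D z2.
    apply: (dvdz_unit_square pb2).
    by apply: (@dvdz_eq _ (b1 * q * (c * c) - n * (z0 * z0) - q * q * u)); lin E1.
  have d3 : D z3.
    apply: (dvdz_unit_square pb12).
    by apply: (@dvdz_eq _ (b1 * q * (c * c) + 3 * n * (z0 * z0) - q * q * v)); lin E2.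
  rewrite d3 d2 /= andbT; apply: (dvdz_unit_square pn).
  case/dvdz_ex: d2 => b ?; subst z2.
  by apply: (@dvdz_eq2 _ (b1 * (c * c) - b2 * (b * b) - q * u)); lin E1.
have e1 : D (b2 * (z2 * z2) - b1 * (z1 * z1)).
  by apply: (@dvdz_eq _ (- n * (z0 * z0) - q * q * u)); lin E1.
have e2 : D (b1 * (b2 * (z3 * z3) - 1 * (z1 * z1))).
  by apply: (@dvdz_eq _ (3 * n * (z0 * z0) - q * q * v)); lin E2.
split; last by rewrite mulrC; apply: add_legendre_of_squares e1.
rewrite -[b2]mulr1; apply: (@add_legendre_of_squares _ p_odd _ _ z3 z1) => //.
by move: e2; rewrite prime_dvdzM (negPf pb1).
Qed.

Lemma necessary10 : cov ((q * n)%:~R : Qp p) (q * b1)%:~R b2%:~R ->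
  leg b2 = 0 /\ leg (b1 * n) = 0.
Proof.
move=> /cov_residues3[z0 [z1 [z2 [z3 [u [v [nz E1 E2]]]]]]].
have d2 : D z2.
  apply: (dvdz_unit_square pb2).
  by apply: (@dvdz_eq _ (b1 * (z1 * z1) - n * (z0 * z0) - q * q * u)); lin E1.
rewrite d2 in nz; case/dvdz_ex: d2 => b ?; subst z2.
have d0 : ~~ D z0.
  apply: contra nz => /[dup] d0 /dvdz_ex[a ?]; subst z0; rewrite d0 /=.
  have d1 : D z1.
    apply: (dvdz_unit_square pb1).
    by apply: (@dvdz_eq2 _ (b2 * (b * b) + n * q * (a * a) + q * u)); lin E1.
  rewrite d1 /=; case/dvdz_ex: d1 => c ?; subst z1.
  apply: (dvdz_unit_square pb12).
  by apply: (@dvdz_eq2 _ (b1 * q * (c * c) + 3 * n * q * (a * a) - q * v)); lin E2.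
have e1 : D (b1 * (z1 * z1) - n * (z0 * z0)).
  by apply: (@dvdz_eq2 _ (b2 * (b * b) + q * u)); lin E1.
have d1 : ~~ D (2 * z1).
  rewrite prime_dvdzM negb_or p2; apply: contra d0 => d1.
  apply: (dvdz_unit_square pn).
  have -> : n * (z0 * z0) = b1 * z1 * z1 - (b1 * (z1 * z1) - n * (z0 * z0)) by ring.
  by rewrite rpredB // dvdz_mull.
have e2 : D (b1 * (b2 * (z3 * z3) - 1 * ((2 * z1) * (2 * z1)))).
  (* This combination eliminates [z0]; its term 4 b1 z1^2 is the origin of the square of 2 z1. *)
  have E3 := congr2 (fun x y => x + 3 * y) E2 E1; rewrite /= in E3.
  by apply: (@dvdz_eq2 _ (- 3 * b2 * (b * b) - q * v - 3 * q * u)); lin E3.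
split; last exact: add_legendre_of_squares e1.
rewrite -[b2]mulr1; apply: (@add_legendre_of_squares _ p_odd _ _ z3 (2 * z1)) => //.
by move: e2; rewrite prime_dvdzM (negPf pb1).
Qed.

Lemma necessary01 : ~~ D 3 -> cov ((q * n)%:~R : Qp p) b1%:~R (q * b2)%:~R ->
  leg (b2 * - n) = 0 /\ leg (b1 * b2 * (3 * n)) = 0.
Proof.
move=> p3 /cov_residues3[z0 [z1 [z2 [z3 [u [v [nz E1 E2]]]]]]].
have p3n : ~~ D (3 * n) by rewrite prime_dvdzM negb_or p3.
have d1 : D z1.
  apply: (dvdz_unit_square pb1).
  by apply: (@dvdz_eq _ (b2 * (z2 * z2) + n * (z0 * z0) + q * q * u)); lin E1.
rewrite d1 in nz; case/dvdz_ex: d1 => c ?; subst z1.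
have d0 : ~~ D z0.
  apply: contra nz => /[dup] d0 /dvdz_ex[a ?]; subst z0; rewrite d0 /=.
  apply/andP; split.
    apply: (dvdz_unit_square pb2).
    by apply: (@dvdz_eq2 _ (b1 * (c * c) - n * q * (a * a) - q * u)); lin E1.
  apply: (dvdz_unit_square pb12).
  by apply: (@dvdz_eq2 _ (b1 * (c * c) + 3 * n * q * (a * a) - q * v)); lin E2.
split.
  apply: (@add_legendre_of_squares _ p_odd _ _ z2 z0) => //.
  by apply: (@dvdz_eq2 _ (b1 * (c * c) - q * u)); lin E1.
apply: (@add_legendre_of_squares _ p_odd _ _ z3 z0) => //.
by apply: (@dvdz_eq2 _ (b1 * (c * c) - q * v)); lin E2.
Qed.

Lemma necessary11 : ~~ D 3 -> cov ((q * n)%:~R : Qp p) (q * b1)%:~R (q * b2)%:~R ->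
  leg (b2 * - n) = 0 /\ leg (b1 * (3 * - n)) = 0.
Proof.
move=> p3 /cov_residues3[z0 [z1 [z2 [z3 [u [v [nz E1 E2]]]]]]].
have p3n : ~~ D (3 * - n) by rewrite prime_dvdzM negb_or p3.
have d0 : ~~ D z0.
  apply: contra nz => /[dup] d0 /dvdz_ex[a ?]; subst z0; rewrite d0 /=.
  have d1 : D z1.
    apply: (dvdz_unit_square pb1).
    by apply: (@dvdz_eq2 _ (b1 * b2 * (z3 * z3) - 3 * n * q * (a * a) + q * v)); lin E2.
  rewrite d1 /=; case/dvdz_ex: d1 => c ?; subst z1.
  apply/andP; split.
    apply: (dvdz_unit_square pb2).
    by apply: (@dvdz_eq2 _ (b1 * q * (c * c) - n * q * (a * a) - q * u)); lin E1.
  apply: (dvdz_unit_square pb12).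
  by apply: (@dvdz_eq3 _ (b1 * (c * c) + 3 * n * (a * a) - v)); lin E2.
split.
  apply: (@add_legendre_of_squares _ p_odd _ _ z2 (2 * z0)) => //.
    by rewrite prime_dvdzM negb_or p2.
  (* The difference has the term 4n z0^2, read as n times the square of 2 z0. *)
  have E3 := congr2 (fun x y => x - y) E2 E1; rewrite /= in E3.
  by apply: (@dvdz_eq2 _ (b1 * b2 * (z3 * z3) + q * v - q * u)); lin E3.
apply: (@add_legendre_of_squares _ p_odd _ _ z1 z0) => //.
by apply: (@dvdz_eq2 _ (b1 * b2 * (z3 * z3) + q * v)); lin E2.
Qed.

(** At 3 the coefficient of [z0 ^+ 2] in the second equation has valuation 2 instead of 1. The
    valuations (0, 1) then belong to the torsion image that has (1, 1) at the other primes, and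
    conversely. *)
Lemma necessary01_at3 : p = 3 :> nat -> cov ((q * n)%:~R : Qp p) b1%:~R (q * b2)%:~R ->
  leg (b2 * - n) = 0 /\ leg (b1 * - n) = 0.
Proof.
move=> p3 /cov_residues3[z0 [z1 [z2 [z3 [u [v [nz E1 E2]]]]]]].
have q3 : 3 = q by rewrite p3.
rewrite q3 in E2.
have d1 : D z1.
  apply: (dvdz_unit_square pb1).
  by apply: (@dvdz_eq _ (b2 * (z2 * z2) + n * (z0 * z0) + q * q * u)); lin E1.
rewrite d1 in nz; case/dvdz_ex: d1 => c ?; subst z1.
have d3 : D z3.
  apply: (dvdz_unit_square pb12).
  by apply: (@dvdz_eq2 _ (b1 * (c * c) + n * (z0 * z0) - q * v)); lin E2.
rewrite d3 in nz; case/dvdz_ex: d3 => e ?; subst z3.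
have d0 : ~~ D z0.
  apply: contra nz => /[dup] d0 /dvdz_ex[a ?]; subst z0; rewrite d0 /= andbT.
  apply: (dvdz_unit_square pb2).
  by apply: (@dvdz_eq2 _ (b1 * (c * c) - n * q * (a * a) - q * u)); lin E1.
split.
  apply: (@add_legendre_of_squares _ p_odd _ _ z2 z0) => //.
  by apply: (@dvdz_eq2 _ (b1 * (c * c) - q * u)); lin E1.
apply: (@add_legendre_of_squares _ p_odd _ _ c z0) => //.
by apply: (@dvdz_eq3 _ (b1 * b2 * (e * e) + v)); lin E2.
Qed.

Lemma necessary11_at3 : p = 3 :> nat ->
  cov ((q * n)%:~R : Qp p) (q * b1)%:~R (q * b2)%:~R ->
  leg (b2 * - n) = 0 /\ leg (b1 * b2 * n) = 0.
Proof.
move=> p3 /cov_residues3[z0 [z1 [z2 [z3 [u [v [nz E1 E2]]]]]]].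
have q3 : 3 = q by rewrite p3.
rewrite q3 in E2.
have d1 : D z1.
  apply: (dvdz_unit_square pb1).
  by apply: (@dvdz_eq2 _ (b1 * b2 * (z3 * z3) - n * (z0 * z0) + q * v)); lin E2.
rewrite d1 in nz; case/dvdz_ex: d1 => c ?; subst z1.
have d0 : ~~ D z0.
  apply: contra nz => /[dup] d0 /dvdz_ex[a ?]; subst z0; rewrite d0 /=.
  apply/andP; split.
    apply: (dvdz_unit_square pb2).
    by apply: (@dvdz_eq2 _ (b1 * q * (c * c) - n * q * (a * a) - q * u)); lin E1.
  apply: (dvdz_unit_square pb12).
  by apply: (@dvdz_eq3 _ (b1 * (c * c) + n * q * (a * a) - v)); lin E2.
split.
  apply: (@add_legendre_of_squares _ p_odd _ _ z2 z0) => //.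
  by apply: (@dvdz_eq2 _ (b1 * q * (c * c) - q * u)); lin E1.
apply: (@add_legendre_of_squares _ p_odd _ _ z3 z0) => //.
by apply: (@dvdz_eq3 _ (b1 * (c * c) - v)); lin E2.
Qed.

End Ramified.
End OddPrime.

(** * Local points at odd primes *)

(** The quotient x / z^2 is the abscissa of the corresponding point of the curve; a separate z keeps
    x integral for points with a denominator, which are needed at 2. *)
Lemma cov_of_squares (K : fieldType) (n b1 b2 x z : K) :
  b1 != 0 -> b2 != 0 -> z != 0 ->
  is_square (b1 * x) -> is_square (b2 * (x - n * z ^+ 2)) ->
  is_square (b1 * b2 * (x + 3 * n * z ^+ 2)) -> cov n b1 b2.
Proof.
move=> b10 b20 z0 [s1 h1] [s2 h2] [s3 h3].
exists z, (s1 / b1), (s2 / b2), (s3 / (b1 * b2)); split.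
- by rewrite (negPf z0).
- rewrite !exprMn !exprVn h1 h2; field; by rewrite b10 b20.
- rewrite !exprMn !exprVn h1 h3; field; by rewrite b10 b20.
Qed.

Section OddPrime.
Variable p : prime_nat.
Hypothesis p_odd : odd p.
Implicit Types a b n z : int.
Let pr : prime p := primeP p.
Local Notation D a := (p %| a)%Z.
Local Notation q := (p%:Z).
Local Notation leg a := (add_legendre a p).

Lemma same_class1 b : ~~ D b -> leg b = 0 -> same_class (b%:~R : Qp p) 1.
Proof.
move=> nb h; rewrite -[1]/(1%:~R); apply: same_class_add_legendre; rewrite ?mulr1 //.
by rewrite dvdzE /= dvdn1; have := prime_gt1 pr; case: (p : nat) => [|[]].
Qed.

Lemma same_classM (K : fieldType) (c a b : K) : same_class a b -> same_class (c * a) (c * b).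
Proof. by case=> r r0 ->; exists r; rewrite ?mulrA. Qed.

Lemma cov_good n b1 b2 : ~~ D 3 -> ~~ D n -> ~~ D b1 -> ~~ D b2 ->
  cov (n%:~R : Qp p) b1%:~R b2%:~R.
Proof.
move=> p3 pn pb1 pb2.
have [h|] := boolP ((leg b1 == 0) && (leg b2 == 0)).
  case/andP: h => /eqP h1 /eqP h2.
  apply: cov_same_class (cov_torsion0 (n%:~R : Qp p)); try exact: same_class1.
  exact: same_class_refl.
have F_odd : odd #|'F_p| by rewrite card_Fp.
have n0 a : ~~ D a -> a%:~R != 0 :> 'F_p by rewrite intr_Fp_eq0.
rewrite negb_and !add_legendreE // => h.
have nb : (chi (b1%:~R : 'F_p) != 1) || (chi (b2%:~R : 'F_p) != 1).
  have c (a : int) : (a == -1)%:R != 0 :> 'F_2 -> a != 1 by case: (a =P -1) => [->|]; rewrite ?eqxx.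
  by case/orP: h => /c ->; rewrite ?orbT.
have [x [h1 h2 h3]] := finField_two_cover F_odd (n0 3 p3) (n0 n pn) (n0 b1 pb1) (n0 b2 pb2) nb.
have sq a : (a = 0) \/ ~~ D a -> chi (a%:~R : 'F_p) != -1 -> is_square (a%:~R : Qp p).
  case=> [-> _|na ha]; first by exists 0; rewrite expr0n.
  by apply: is_square_add_legendre => //; rewrite add_legendreE // (negPf ha).
(* Only unit squares lift by Hensel's lemma. When x is a root modulo p, the lift is the exact root
   0, n or -3n: the factor in question is the square 0, and the others are units because p does not
   divide n, 3n or 4n. *)
have [X [XE X1 X2 X3]] : exists X : int, [/\ x = X%:~R, X = 0 \/ ~~ D X,
    X - n = 0 \/ ~~ D (X - n) & X + 3 * n = 0 \/ ~~ D (X + 3 * n)].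
  have [X XE] := Fp_intr x.
  have p3n : ~~ D (3 * n) by rewrite prime_dvdzM negb_or p3.
  have p4n : ~~ D (2 * 2 * n) by rewrite !prime_dvdzM !negb_or prime_dvdz2.
  have [d1|d1] := boolP (D X).
    exists 0; split; first by rewrite XE; apply/eqP; rewrite intr_Fp_eq // subr0.
    - by left.
    - by right; rewrite sub0r rpredN.
    - by right; rewrite add0r.
  have [d2|d2] := boolP (D (X - n)).
    exists n; split; first by rewrite XE; apply/eqP; rewrite intr_Fp_eq.
    - by right.
    - by left; rewrite subrr.
    - by right; have -> : n + 3 * n = 2 * 2 * n by ring.
  have [d3|d3] := boolP (D (X + 3 * n)); last by exists X; split; [|right|right|right].
  exists (- (3 * n)); split; first by rewrite XE; apply/eqP; rewrite intr_Fp_eq // opprK.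
  - by right; rewrite rpredN.
  - right; have -> : - (3 * n) - n = - (2 * 2 * n) by ring.
    by rewrite rpredN.
  - by left; rewrite addNr.
have M a b : ~~ D a -> b = 0 \/ ~~ D b -> a * b = 0 \/ ~~ D (a * b).
  by move=> na [->|nb']; [left; rewrite mulr0|right; rewrite prime_dvdzM negb_or na].
apply: (@cov_of_squares _ _ _ _ X%:~R 1).
- exact: intr_Qp_neq0 (not_dvdz_neq0 pb1).
- exact: intr_Qp_neq0 (not_dvdz_neq0 pb2).
- exact: oner_neq0.
- rewrite -intrM; apply: sq; first exact: M.
  by rewrite intrM -XE.
- rewrite expr1n mulr1 -intrB -intrM; apply: sq; first exact: M.
  by rewrite intrM intrB -XE.
- rewrite expr1n mulr1 -[3]/(3%:~R) -!intrM -intrD -intrM; apply: sq.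
    by apply: M => //; rewrite prime_dvdzM negb_or pb1.
  by rewrite intrM intrM intrD intrM -XE.
Qed.

Lemma opp_intrM (R : pzRingType) a b : - (a * b)%:~R = a%:~R * (- b)%:~R :> R.
Proof. by rewrite intrM rmorphN mulrN. Qed.

Section Ramified.
Variables n b1 b2 : int.
Hypotheses (pn : ~~ D n) (pb1 : ~~ D b1) (pb2 : ~~ D b2).
Let pNn : ~~ D (- n). Proof. by rewrite rpredN. Qed.

Lemma sufficient00 (m : int) : leg b2 = 0 -> leg b1 = 0 ->
  cov (m%:~R : Qp p) b1%:~R b2%:~R.
Proof.
move=> h2 h1; apply: cov_same_class (cov_torsion0 (m%:~R : Qp p)); try exact: same_class1.
exact: same_class_refl.
Qed.

Lemma sufficient10 : leg b2 = 0 -> leg (b1 * n) = 0 ->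
  cov ((q * n)%:~R : Qp p) (q * b1)%:~R b2%:~R.
Proof.
move=> h2 h1; apply: cov_same_class (cov_torsion2 ((q * n)%:~R : Qp p)).
- exact: same_class_refl.
- by rewrite !intrM; apply: same_classM; apply: same_class_add_legendre.
- exact: same_class1.
Qed.

Lemma sufficient01 : ~~ D 3 -> leg (b2 * - n) = 0 -> leg (b1 * -3) = 0 ->
  cov ((q * n)%:~R : Qp p) b1%:~R (q * b2)%:~R.
Proof.
move=> p3 h2 h1; apply: cov_same_class (cov_torsion1 ((q * n)%:~R : Qp p)).
- exact: same_class_refl.
- rewrite -[3]/(3%:~R) -rmorphN; apply: same_class_add_legendre => //.
- by rewrite opp_intrM intrM; apply: same_classM; apply: same_class_add_legendre.
Qed.

Lemma sufficient11 : ~~ D 3 -> leg (b2 * - n) = 0 -> leg (b1 * (3 * - n)) = 0 ->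
  cov ((q * n)%:~R : Qp p) (q * b1)%:~R (q * b2)%:~R.
Proof.
move=> p3 h2 h1; apply: cov_same_class (cov_torsion3 ((q * n)%:~R : Qp p)).
- exact: same_class_refl.
- have -> : - (3 * (q * n)%:~R) = q%:~R * (3 * - n)%:~R :> Qp p.
    by rewrite -[3 in LHS]/(3%:~R) -intrM mulrCA opp_intrM mulrN.
  rewrite intrM; apply: same_classM; apply: same_class_add_legendre => //.
  by rewrite prime_dvdzM negb_or p3.
- by rewrite opp_intrM intrM; apply: same_classM; apply: same_class_add_legendre.
Qed.

Lemma sufficient01_at3 : p = 3 :> nat -> leg (b2 * - n) = 0 -> leg (b1 * - n) = 0 ->
  cov ((q * n)%:~R : Qp p) b1%:~R (q * b2)%:~R.
Proof.
move=> p3 h2 h1; apply: cov_same_class (cov_torsion3 ((q * n)%:~R : Qp p)).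
- exact: same_class_refl.
- have [r r0 E] := same_class_add_legendre p_odd pb1 pNn h1.
  have q0 : (3 : Qp p) != 0 by rewrite -[3]/(3%:~R) intr_Qp_neq0.
  (* The first entry of the torsion image is -9n, whose factor 9 is absorbed by the division by
     3. *)
  exists (r / 3); first by rewrite mulf_neq0 ?invr_eq0.
  by rewrite E p3 intrM rmorphN /= -[3%:Z%:~R]/(3 : Qp p); field.
- by rewrite opp_intrM intrM; apply: same_classM; apply: same_class_add_legendre.
Qed.

Lemma sufficient11_at3 : p = 3 :> nat -> leg (b2 * - n) = 0 -> leg (b1 * -1) = 0 ->
  cov ((q * n)%:~R : Qp p) (q * b1)%:~R (q * b2)%:~R.
Proof.
move=> p3 h2 h1; apply: cov_same_class (cov_torsion1 ((q * n)%:~R : Qp p)).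
- exact: same_class_refl.
- have -> : (- 3 : Qp p) = q%:~R * (-1)%:~R by rewrite p3 rmorphN mulrN1.
  rewrite intrM; apply: same_classM; apply: same_class_add_legendre => //.
  by rewrite dvdzE /= dvdn1 p3.
- by rewrite opp_intrM intrM; apply: same_classM; apply: same_class_add_legendre.
Qed.

End Ramified.
End OddPrime.

Ltac F2_closed :=
  first [apply/eqP; vm_compute; reflexivity
        | match goal with H : _ = _ :> 'F_2 |- _ =>
            exfalso; move/eqP: H; vm_compute; discriminate end].

(** A truth table over the Legendre symbols that occur, viewed as arbitrary elements of F_2. *)
Ltac F2_cases :=
  repeat match goal with |- context [add_legendre ?a ?p] =>
    let x := fresh "x" in move: (add_legendre a p) => x end;
  repeat match goal with x : 'F_2 |- _ => destruct (F2P x); subst x end;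
  intros; repeat split; F2_closed.

Section OddPrime.
Variable p : prime_nat.
Hypothesis p_odd : odd p.
Let pr : prime p := primeP p.
Local Notation D a := (p %| a)%Z.
Local Notation q := (p%:Z).
Local Notation leg a := (add_legendre a p).
Variables n b1 b2 : int.
Hypotheses (pn : ~~ D n) (pb1 : ~~ D b1) (pb2 : ~~ D b2).

Let pN (a : int) : ~~ D a -> ~~ D (- a). Proof. by rewrite rpredN. Qed.
Let pM (a b : int) : ~~ D a -> ~~ D b -> ~~ D (a * b).
Proof. by move=> ha hb; rewrite prime_dvdzM negb_or ha. Qed.
Let legM (a b : int) : ~~ D a -> ~~ D b -> leg (a * b) = leg a + leg b.
Proof. exact: add_legendreM. Qed.
Let p1 : ~~ D 1. Proof. by rewrite dvdzE /= dvdn1; have := prime_gt1 pr; lia. Qed.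
Let legN (a : int) : ~~ D a -> leg (- a) = leg (-1) + leg a.
Proof. by move=> ha; rewrite -[in LHS]mulN1r legM //; exact: (pN p1). Qed.

(** The torsion images are generated by (qn, 1) and (-3, -qn), of valuations (1, 0) and (0, 1). So x
    multiplies the symbols of the unit parts of the first generator and y those of the second. *)
Lemma cov_ramifiedP (x y : 'F_2) : ~~ D 3 ->
  cov ((q * n)%:~R : Qp p) (q ^+ x * b1)%:~R (q ^+ y * b2)%:~R <->
  leg b2 + y * leg (- n) = 0 /\ leg b1 + x * leg n + y * leg (-3) = 0.
Proof.
move=> p3.
have e3 : leg (-3) = leg (-1) + leg 3 by apply: (legN p3).
case: (F2P x) => ?; subst x; case: (F2P y) => ? /=; subst y;
  rewrite ?expr0 ?expr1 ?mul1r ?mul0r ?addr0.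
- split=> [/(necessary00 p_odd pn pb1 pb2)[]|[h2 h1]]; last exact: sufficient00.
  by rewrite legM //; F2_cases.
- split=> [/(necessary01 p_odd pn pb1 pb2 p3)[]|[h2 h1]].
    rewrite !legM ?pM ?pN // e3 ?(legN pn); F2_cases.
  apply: sufficient01 => //; rewrite legM ?pM ?pN //.
- split=> [/(necessary10 p_odd pn pb1 pb2)[]|[h2 h1]].
    by rewrite legM.
  by apply: sufficient10 => //; rewrite legM.
- split=> [/(necessary11 p_odd pn pb1 pb2 p3)[]|[h2 h1]].
    rewrite !legM ?pM ?pN // e3 ?(legN pn); F2_cases.
  apply: sufficient11 => //; move: h2 h1; rewrite !legM ?pM ?pN // e3 ?(legN pn); F2_cases.
Qed.

(** As in the previous lemma, but the generator with valuation parities (0, 1) is now (-9n, -3n),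
    whose unit parts are both -n up to squares. *)
Lemma cov_at3P (x y : 'F_2) : p = 3 :> nat ->
  cov ((q * n)%:~R : Qp p) (q ^+ x * b1)%:~R (q ^+ y * b2)%:~R <->
  leg b2 + y * leg (- n) = 0 /\ leg b1 + x * leg n + y * leg (- n) = 0.
Proof.
move=> p3.
case: (F2P x) => ?; subst x; case: (F2P y) => ? /=; subst y;
  rewrite ?expr0 ?expr1 ?mul1r ?mul0r ?addr0.
- split=> [/(necessary00 p_odd pn pb1 pb2)[]|[h2 h1]]; last exact: sufficient00.
  by rewrite legM //; F2_cases.
- split=> [/(necessary01_at3 p_odd pn pb1 pb2 p3)[]|[h2 h1]].
    by rewrite !legM ?pM ?pN.
  by apply: sufficient01_at3 => //; rewrite legM ?pM ?pN.
- split=> [/(necessary10 p_odd pn pb1 pb2)[]|[h2 h1]].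
    by rewrite legM.
  by apply: sufficient10 => //; rewrite legM.
- split=> [/(necessary11_at3 p_odd pn pb1 pb2 p3)[]|[h2 h1]].
    rewrite !legM ?pM ?pN // ?(legN pn); F2_cases.
  apply: sufficient11_at3 => //; move: h2 h1; rewrite !legM ?pM ?pN // ?(legN pn); F2_cases.
Qed.

End OddPrime.

(** * The prime 2 *)

Definition is3mod4 (c : nat) : bool := (c %% 4 == 3)%N.
Definition is35mod8 (c : nat) : bool := (c %% 8 \in [:: 3; 5])%N.

(* [b1 = 2^x c1] and [b2 = 2^y c2] with [c1] and [c2] odd. *)
Definition soluble2 (n : nat) (x : bool) (c1 : nat) (y : bool) (c2 : nat) : bool :=
  ~~ x && (if n %% 8 == 1 then (y == is3mod4 c1) && ~~ (is3mod4 c2 (+) y (+) is35mod8 c1)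
           else if n %% 8 == 5 then ~~ y && ~~ is3mod4 c1
           else ~~ y && ~~ is3mod4 c2)%N.

(** The [s] range over the squares modulo 16, and primitivity says that one of them is odd. Terms
    are moved across so that no subtraction occurs. *)
Definition test_residues16 (n b1 b2 : nat) : bool :=
  has (fun s0 => has (fun s1 => has (fun s2 => has (fun s3 =>
    if ((b1 * s1) %% 16 == (b2 * s2 + n * s0) %% 16)%N then
      if ((b1 * s1 + 3 * n * s0) %% 16 == (b1 * b2 * s3) %% 16)%N
      then [|| odd s0, odd s1, odd s2 | odd s3] else false
    else false)
  [:: 0; 1; 4; 9]) [:: 0; 1; 4; 9]) [:: 0; 1; 4; 9]) [:: 0; 1; 4; 9]%N.

(** Zero, or 4^k times an integer that is 1 modulo 8, for k up to 3: a sufficient test for being a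
    2-adic square. *)
Definition test_square2 (m : int) : bool :=
  [|| m == 0, (m %% 8 == 1)%Z, (m %% 32 == 4)%Z, (m %% 128 == 16)%Z | (m %% 512 == 64)%Z].

Definition test_point2 (n b1 b2 x z : int) : bool :=
  [&& test_square2 (b1 * x), test_square2 (b2 * (x - n * z ^+ 2))
    & test_square2 (b1 * b2 * (x + 3 * n * z ^+ 2))].

(* Every soluble class other than (1, 1) has a point with [z = 1] or with
   [(x, z) = (1, 2)]; the values of [x] come from a search. *)
Definition test_points2 (n b1 b2 : int) : bool :=
  [|| (b1 == 1) && (b2 == 1), test_point2 n b1 b2 1 2
    | has (fun x => test_point2 n b1 b2 x 1)
        [:: 0; 1; 3; 5; 7; -1; -5; -9; -12; -15; -21; -25; -31; -37; -41; -43; -45]].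

Definition odd_residues := [:: 1; 3; 5; 7]%N.

(** There are 4 classes of odd n modulo 8 and 8 classes for each of b1 and b2. In each of these 256
    cases there is an explicit point or an obstruction modulo 16, as [soluble2] predicts. *)
Lemma residue_tests_agree :
  all (fun n => all (fun x : bool => all (fun c1 => all (fun y : bool => all (fun c2 =>
    let b1 := (2 ^ x * c1)%N in let b2 := (2 ^ y * c2)%N in
    if soluble2 n x c1 y c2 then test_points2 n b1 b2 else ~~ test_residues16 n b1 b2)
  odd_residues) [:: false; true]) odd_residues) [:: false; true]) odd_residues.
Proof. by vm_compute. Qed.

Lemma eqn_mod_of_int (m a b : nat) (c : int) :
  a%:Z - b%:Z = m%:Z * c -> (a %% m == b %% m)%N.
Proof.
by move=> h; rewrite -eqz_nat -!modz_nat eqz_mod_dvd h dvdz_mulr.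
Qed.

Section Two.
Variable p : prime_nat.
Hypothesis p2 : p = 2 :> nat.

Lemma test_square2P (m : int) : test_square2 m -> is_square (m%:~R : Qp p).
Proof.
have sq4 (a k : int) : m = a * a * (8 * k + 1) -> is_square (m%:~R : Qp p).
  move=> ->; have [|s hs] := @is_square_Q2 p (8 * k + 1) p2.
    by rewrite addrK dvdz_mulr.
  by exists (a%:~R * s); rewrite exprMn hs expr2 -!intrM.
move=> /or4P[/eqP->|/eqP h|/eqP h|/orP[]/eqP h].
- by exists 0; rewrite expr0n.
- by apply: (sq4 1 (m %/ 8)%Z); rewrite {1}(divz_eq m 8) h; ring.
- by apply: (sq4 2 (m %/ 32)%Z); rewrite {1}(divz_eq m 32) h; ring.
- by apply: (sq4 4 (m %/ 128)%Z); rewrite {1}(divz_eq m 128) h; ring.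
- by apply: (sq4 8 (m %/ 512)%Z); rewrite {1}(divz_eq m 512) h; ring.
Qed.

Lemma cov_test_points2 (n b1 b2 : int) : b1 != 0 -> b2 != 0 ->
  test_points2 n b1 b2 -> cov (n%:~R : Qp p) b1%:~R b2%:~R.
Proof.
move=> b10 b20.
have main (x z : int) : z != 0 -> test_point2 n b1 b2 x z ->
    cov (n%:~R : Qp p) b1%:~R b2%:~R.
  move=> z0 /and3P[/test_square2P h1 /test_square2P h2 /test_square2P h3].
  apply: (@cov_of_squares _ _ _ _ x%:~R z%:~R); try exact: intr_Qp_neq0.
  - by rewrite -intrM.
  - by rewrite !(intrM, intrB, rmorphXn) in h2.
  - by rewrite !(intrM, intrD, rmorphXn) in h3.
case/or3P => [/andP[/eqP-> /eqP->]|h|/hasP[x _ h]].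
- exact: cov_torsion0.
- exact: main h.
- exact: main h.
Qed.

Lemma cov_test_residues16 (n b1 b2 : nat) :
  cov (n%:~R : Qp p) b1%:~R b2%:~R -> test_residues16 n b1 b2.
Proof.
move=> /(@cov_residues p n b1 b2 4 isT)[z0 [z1 [z2 [z3 []]]]].
rewrite p2 => nz E1' E2'.
have E1 : (16 %| b1%:Z * z1 ^+ 2 - b2%:Z * z2 ^+ 2 - n%:Z * z0 ^+ 2)%Z := E1'.
have E2 : (16 %| b1%:Z * z1 ^+ 2 - b1%:Z * b2%:Z * z3 ^+ 2 + 3 * n%:Z * z0 ^+ 2)%Z := E2'.
clear E1' E2'.
have sqP (z : int) : exists s : nat, [/\ s \in [:: 0; 1; 4; 9]%N, ~~ odd s -> (2 %| z)%Z
    & exists k : int, z ^+ 2 = 16 * k + s%:Z].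
  have E := divz_eq z 16; set k := (z %/ 16)%Z in E.
  have : [/\ (0 <= z %% 16)%Z & (z %% 16 < 16)%Z] by lia.
  case: (z %% 16)%Z E => [r E [_ r16]|r E [] //].
  exists ((r * r) %% 16)%N; split.
  - by do 16?[case: r E r16 => [|r] E r16 //].
  - move=> h; have : ~~ odd r by do 16?[case: r E r16 h => [|r] E r16 h //].
    by lia.
  - exists (16 * k * k + 2 * k * r%:Z + ((r * r) %/ 16)%N%:Z).
    have := divn_eq (r * r) 16; move: (_ %/ _)%N (_ %% _)%N => u v uv.
    have uv' : r%:Z * r = u * 16 + v by rewrite -!PoszM uv PoszD PoszM.
    by rewrite E; lin uv'.
have [s0 [i0 o0 [k0 e0]]] := sqP z0; have [s1 [i1 o1 [k1 e1]]] := sqP z1.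
have [s2 [i2 o2 [k2 e2]]] := sqP z2; have [s3 [i3 o3 [k3 e3]]] := sqP z3.
apply/hasP; exists s0 => //; apply/hasP; exists s1 => //.
apply/hasP; exists s2 => //; apply/hasP; exists s3 => //.
have -> : ((b1 * s1) %% 16 == (b2 * s2 + n * s0) %% 16)%N.
  move: E1; rewrite e0 e1 e2 => /dvdzP[w hw].
  have : (b1 * s1)%N%:Z - (b2 * s2 + n * s0)%N%:Z = 16 * (w - b1%:Z * k1 + b2%:Z * k2 + n%:Z * k0).
    by rewrite !(PoszM, PoszD); lin hw.
  exact: eqn_mod_of_int.
have -> : ((b1 * s1 + 3 * n * s0) %% 16 == (b1 * b2 * s3) %% 16)%N.
  move: E2; rewrite e0 e1 e3 => /dvdzP[w hw].
  have : (b1 * s1 + 3 * n * s0)%N%:Z - (b1 * b2 * s3)%N%:Z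
    = 16 * (w - b1%:Z * k1 - 3 * n%:Z * k0 + b1%:Z * b2%:Z * k3).
    by rewrite !(PoszM, PoszD); lin hw.
  exact: eqn_mod_of_int.
apply: contraR nz; rewrite !negb_or => /and4P[h0 h1 h2 h3].
by rewrite o0 ?o1 ?o2 ?o3.
Qed.

Lemma odd_square_mod8 (c : int) : odd `|c| -> exists e, c * c = 8 * e + 1.
Proof.
move=> oc; have [d ->] : exists d, c = 2 * d + 1 by exists (c %/ 2)%Z; lia.
have [e he] : exists e, d * (d + 1) = 2 * e.
  have [f [->|->]] : exists f, d = 2 * f \/ d = 2 * f + 1 by exists (d %/ 2)%Z; lia.
    by exists (f * (2 * f + 1)); ring.
  by exists ((2 * f + 1) * (f + 1)); ring.
exists e; transitivity (4 * (d * (d + 1)) + 1); first by ring.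
by rewrite he; ring.
Qed.

(** The product ac is congruent to the odd square c^2, hence to 1, modulo 8. *)
Lemma same_class2 (a c : int) : odd `|a| -> (8 %| a - c)%Z ->
  same_class (a%:~R : Qp p) c%:~R.
Proof.
move=> oa /dvdzP[k ac]; have oc : odd `|c| by lia.
apply: same_class_is_square; try by apply: intr_Qp_neq0; lia.
rewrite -intrM; apply: is_square_Q2 => //.
have [e he] := odd_square_mod8 oc.
apply/dvdzP; exists (k * c + e).
have -> : a = c + k * 8 by lia.
by lin he.
Qed.

Lemma cov_at2P (n c1 c2 : int) (x y : bool) : odd `|n| -> odd `|c1| -> odd `|c2| ->
  cov (n%:~R : Qp p) (2 ^+ x * c1)%:~R (2 ^+ y * c2)%:~R <->
  soluble2 `|(n %% 8)%Z| x `|(c1 %% 8)%Z| y `|(c2 %% 8)%Z|.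
Proof.
move=> on o1 o2.
have resP (a : int) : odd `|a| -> exists r : nat, [/\ `|(a %% 8)%Z|%N = r, r \in odd_residues,
    odd r & (8 %| a - r%:Z)%Z].
  move=> oa; exists `|(a %% 8)%Z|%N; split=> //.
  - have : (`|(a %% 8)%Z| < 8)%N by lia.
    have : odd `|(a %% 8)%Z| by lia.
    by case: `|(a %% 8)%Z|%N => [|[|[|[|[|[|[|[|r]]]]]]]].
  - by lia.
  - by lia.
have [rn [-> in_ odn dn]] := resP n on.
have [r1 [-> i1 od1 d1]] := resP c1 o1.
have [r2 [-> i2 od2 d2]] := resP c2 o2.
have dC (a b : int) : (8 %| a - b)%Z -> (8 %| b - a)%Z by rewrite -opprB rpredN.
have -> : cov (n%:~R : Qp p) (2 ^+ x * c1)%:~R (2 ^+ y * c2)%:~R <->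
  cov (rn%:~R : Qp p) (2 ^ x * r1)%N%:~R (2 ^ y * r2)%N%:~R.
  have eP (z r : nat) : (2 ^ z * r)%N%:Z = 2 ^+ z * r%:Z by rewrite PoszM -natz natrX.
  rewrite !eP !(intrM _ (2 ^+ _)).
  by split; apply: cov_same_class; try apply: same_classM; apply: same_class2 => //; apply: dC.
have mem2 (z : bool) : z \in [:: false; true] by case: z.
have := allP (allP (allP residue_tests_agree rn in_) x (mem2 x)) r1 i1.
move=> /allP /(_ y (mem2 y)) /allP /(_ r2 i2).
rewrite /=; case: ifP => _ h; split=> //.
- move=> _; apply: cov_test_points2 h; rewrite eqz_nat muln_eq0 expn_eq0 /= -lt0n odd_gt0 //.
- by move=> /cov_test_residues16; rewrite (negPf h).
Qed.
End Two.

(** * The real place and the passage from rationals to integers *)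

Lemma pos_same_class (R : rcfType) (a b : R) : 0 < a * b -> same_class a b.
Proof.
move=> ab; have := lt0r_neq0 ab; rewrite mulf_eq0 negb_or => /andP[a0 b0].
apply: same_class_is_square => //; exists (Num.sqrt (a * b)).
by rewrite sqr_sqrtr // ltW.
Qed.

(** Equal signs are realised by the torsion images (1, 1) and (-3, -n). Opposite signs make one of
    the equations definite: the second if b1 > 0, the first if b1 < 0. *)
Lemma cov_realP (R : rcfType) (n b1 b2 : R) : 0 < n -> b1 != 0 -> b2 != 0 ->
  cov n b1 b2 <-> (0 < b1) = (0 < b2).
Proof.
move=> n0 b10 b20; split; last first.
  case: (ltrP 0 b1) => h1 /esym h2.
    apply: cov_same_class (cov_torsion0 n); first exact: same_class_refl.
      by apply: pos_same_class; rewrite mulr1.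
    by apply: pos_same_class; rewrite mulr1.
  have {}h1 : b1 < 0 by rewrite lt_neqAle b10.
  have {}h2 : b2 < 0 by rewrite lt_neqAle b20 leNgt h2.
  apply: cov_same_class (cov_torsion1 n); first exact: same_class_refl.
    by apply: pos_same_class; nra.
  by apply: pos_same_class; nra.
move=> [z0 [z1 [z2 [z3 [/negP nz e1 e2]]]]].
have sq0 (a z : R) : 0 < a -> a * z ^+ 2 <= 0 -> z = 0.
  move=> a0; rewrite pmulr_rle0 // => z0'; apply/eqP.
  by rewrite -sqrf_eq0 eq_le z0' sqr_ge0.
case: (ltrgt0P b1) b10 => // h1 _; case: (ltrgt0P b2) b20 => // h2 _; exfalso; apply: nz.
  have := sqr_ge0 z1; have := sqr_ge0 z3; have := sqr_ge0 z0 => g0 g3 g1.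
  have m : 0 < b1 * - b2 by nra.
  have z00 : z0 = 0 by apply: (sq0 n) => //; nra.
  have z10 : z1 = 0 by apply: (sq0 b1) => //; nra.
  have z30 : z3 = 0 by apply: (sq0 (b1 * - b2)) => //; nra.
  have z20 : z2 = 0 by apply: (sq0 (- b2)); [nra|rewrite z00 z10 in e1; nra].
  by rewrite z00 z10 z20 z30 eqxx.
have := sqr_ge0 z1; have := sqr_ge0 z2; have := sqr_ge0 z0 => g0 g2 g1.
have z00 : z0 = 0 by apply: (sq0 n) => //; nra.
have z10 : z1 = 0 by apply: (sq0 (- b1)); nra.
have z20 : z2 = 0 by apply: (sq0 b2) => //; nra.
have z30 : z3 = 0 by apply: (sq0 (- b1 * b2)); [nra|rewrite z00 z10 in e2; nra].
by rewrite z00 z10 z20 z30 eqxx.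
Qed.

Section Ratr.
Variable K : fieldType.
Hypothesis intr_injK : injective (intr : int -> K).

Lemma intrK_eq0 (m : int) : (m%:~R == 0 :> K) = (m == 0).
Proof. by rewrite -[0 in LHS]/(0%:~R) (inj_eq intr_injK). Qed.

Lemma ratr_div_int (a b : int) : b != 0 -> ratr (a%:~R / b%:~R) = a%:~R / b%:~R :> K.
Proof.
move=> b0; rewrite /ratr; set x : rat := _ / _.
have : x * b%:~R = a%:~R by rewrite /x divfK // intr_eq0.
rewrite -{1}(divq_num_den x) => h.
have : (numq x * b)%:~R = (a * denq x)%:~R :> rat.
  by rewrite !intrM -h; field; rewrite intr_eq0 denq_neq0.
move=> /intr_inj E; have E' : (numq x)%:~R * b%:~R = a%:~R * (denq x)%:~R :> K.
  by rewrite -!intrM E.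
apply/eqP; rewrite eqr_div ?intrK_eq0 ?denq_neq0 //; exact/eqP.
Qed.

(** [ratr] is computed from the reduced fraction; characteristic zero keeps denominators nonzero in
    K, so an unreduced fraction has the same image. *)
Lemma ratrM_inj (x y : rat) : ratr (x * y) = ratr x * ratr y :> K.
Proof.
rewrite -{1}(divq_num_den x) -{1}(divq_num_den y) mulf_div -!intrM ratr_div_int.
  by rewrite /ratr mulf_div !intrM.
by rewrite mulf_neq0 ?denq_neq0.
Qed.

Lemma ratr_neq0 (x : rat) : x != 0 -> ratr x != 0 :> K.
Proof. by move=> x0; rewrite mulf_neq0 ?invr_eq0 ?intrK_eq0 ?numq_eq0 ?denq_neq0. Qed.

Lemma covering_has_pointP (n b1 b2 : int) (r1 r2 : rat) : r1 != 0 -> r2 != 0 ->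
  covering_has_point K 0 n%:~R (- (3 * n)%:~R) (b1%:~R * r1 ^+ 2) (b2%:~R * r2 ^+ 2) <->
  cov (n%:~R : K) b1%:~R b2%:~R.
Proof.
move=> r10 r20.
have sc (b : int) (r : rat) : r != 0 -> same_class (ratr (b%:~R * r ^+ 2) : K) b%:~R.
  move=> r0; exists (ratr r); first exact: ratr_neq0.
  by rewrite !(expr2, ratrM_inj) ratr_int.
have sc' (b : int) (r : rat) : r != 0 -> same_class b%:~R (ratr (b%:~R * r ^+ 2) : K).
  move=> r0; exists (ratr r)^-1; first by rewrite invr_eq0 ratr_neq0.
  by rewrite !(expr2, ratrM_inj) ratr_int; field; rewrite ratr_neq0.
have -> : covering_has_point K 0 n%:~R (- (3 * n)%:~R) (b1%:~R * r1 ^+ 2) (b2%:~R * r2 ^+ 2)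
  = cov (n%:~R : K) (ratr (b1%:~R * r1 ^+ 2)) (ratr (b2%:~R * r2 ^+ 2)).
  rewrite /covering_has_point /cov !subr0 ratr_int -rmorphN ratr_int ratrM_inj.
  by have -> : (- (3 * n))%:~R = - (3 * n%:~R) :> K by rewrite rmorphN rmorphM.
by split; apply: cov_same_class; rewrite ?same_class_refl //; auto; exact: same_class_refl.
Qed.

End Ratr.

Definition locally_soluble (n b1 b2 : int) : Prop :=
  cov (n%:~R : Rdefinitions.R) b1%:~R b2%:~R /\
  forall p : prime_nat, cov (n%:~R : Qp p) b1%:~R b2%:~R.

Lemma everywhere_locally_solubleP (n b1 b2 : int) (r1 r2 : rat) : r1 != 0 -> r2 != 0 ->
  everywhere_locally_soluble 0 n%:~R (- (3 * n)%:~R) (b1%:~R * r1 ^+ 2) (b2%:~R * r2 ^+ 2) <->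
  locally_soluble n b1 b2.
Proof.
move=> r10 r20.
have realP := @covering_has_pointP Rdefinitions.R (@intr_inj _) n b1 b2 r1 r2 r10 r20.
have padicP p := @covering_has_pointP (Qp p) (@intr_Qp_inj p) n b1 b2 r1 r2 r10 r20.
by split=> -[/realP hR hp]; split=> // p; apply/padicP.
Qed.

Lemma squarefree_part (m : nat) : (0 < m)%N ->
  exists s k : nat, [/\ (0 < s)%N, (0 < k)%N, m = (s * k ^ 2)%N
    & forall l, (logn l s <= 1)%N].
Proof.
have [N] := ubnP m; elim: N m => // N IHN m mN m0.
have [/existsP[[l /= _] /andP[pl lm]]|] := boolP [exists l : 'I_m.+1, prime l && (l ^ 2 %| m)%N].
  case/dvdnP: lm => m' mE.
  have m'0 : (0 < m')%N by move: m0; rewrite mE muln_gt0 => /andP[].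
  have l1 := prime_gt1 pl.
  have [|s [k [s0 k0 m'E hs]]] := IHN m' _ m'0.
    apply: leq_trans (_ : (m <= N)%N); last by rewrite -ltnS.
    by rewrite mE -{1}[m']muln1 ltn_mul2l m'0 -{1}(exp1n 2) ltn_exp2r.
  exists s, (k * l)%N; split=> //; first by rewrite muln_gt0 k0 ltnW.
  by rewrite mE m'E expnMn mulnA.
rewrite negb_exists => /forallP h; exists m, 1%N; split; rewrite ?muln1 // => l.
have [pl|/negPf npl] := boolP (prime l); last by rewrite lognE npl.
rewrite leqNgt -pfactor_dvdn //; apply/negP => lm.
have lt : (l < m.+1)%N.
  rewrite ltnS; apply: leq_trans (dvdn_leq m0 lm); rewrite -{1}(expn1 l) leq_exp2l //.
  exact: prime_gt1.
by have /negP := h (Ordinal lt); apply; rewrite /= pl.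
Qed.

(** Numerator over denominator equals their product up to the square of the denominator, so the
    squarefree part of an integer suffices. *)
Lemma squarefree_part_rat (b : rat) : b != 0 ->
  exists (s : nat) (e : bool) (r : rat), [/\ r != 0, (0 < s)%N,
    b = ((-1) ^+ e * s%:Z)%:~R * r ^+ 2 & forall l, (logn l s <= 1)%N].
Proof.
move=> b0; have nd0 : (0 < `|(numq b * denq b)%R|)%N.
  by rewrite absz_gt0 mulf_neq0 ?numq_eq0 ?denq_neq0.
have [s [k [s0 k0 E hs]]] := squarefree_part nd0.
exists s, (numq b * denq b < 0), (k%:R / (denq b)%:~R); split=> //.
  by rewrite mulf_neq0 ?invr_eq0 ?intr_eq0 ?denq_neq0 // pnatr_eq0 -lt0n.
have : numq b * denq b = (-1) ^+ (numq b * denq b < 0)%R * (s * k ^ 2)%N%:Z.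
  by rewrite -E -intEsign.
move: (_ < 0) => e.
rewrite PoszM mulrA => /(congr1 (fun z : int => z%:~R : rat)).
rewrite intrM [RHS]intrM.
move=> h; rewrite exprMn mulrA exprVn.
have kE : (k ^ 2)%N%:~R = k%:R ^+ 2 :> rat by rewrite -pmulrn natrX.
rewrite -kE -h -{1}(divq_num_den b); field.
by rewrite intr_eq0 denq_neq0.
Qed.

(** * The local conditions as linear equations *)

Lemma F2_nat_of_ord (e : 'F_2) : (e : nat) = (e != 0) :> nat.
Proof. by case: (F2P e) => ->. Qed.

(** [chi4] and [chi8] are the additive forms of the characters (-1/c) and (2/c). At a prime they are
    [add_legendre (-1)] and [add_legendre 2], which brings the rows of symbols of -1 and 2 into the
    condition at 2. *)
Definition chi4 (c : int) : 'F_2 := (is3mod4 `|(c %% 8)%Z|)%:R.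
Definition chi8 (c : int) : 'F_2 := (is35mod8 `|(c %% 8)%Z|)%:R.

Lemma odd_residue_cases (a : int) : odd `|a| ->
  (a %% 8)%Z = 1 \/ (a %% 8)%Z = 3 \/ (a %% 8)%Z = 5 \/ (a %% 8)%Z = 7.
Proof. by lia. Qed.

Lemma chi4M (a b : int) : odd `|a| -> odd `|b| -> chi4 (a * b) = chi4 a + chi4 b.
Proof.
rewrite /chi4 -modzMm.
by move=> /odd_residue_cases [->|[->|[->|->]]] /odd_residue_cases [->|[->|[->|->]]]; apply/eqP.
Qed.

Lemma chi8M (a b : int) : odd `|a| -> odd `|b| -> chi8 (a * b) = chi8 a + chi8 b.
Proof.
rewrite /chi8 -modzMm.
by move=> /odd_residue_cases [->|[->|[->|->]]] /odd_residue_cases [->|[->|[->|->]]]; apply/eqP.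
Qed.

(* [phi] is a character into ['F_2] of the multiplicative set [S]. *)
Section Character.
Variables (S : pred int) (phi : int -> 'F_2).
Hypotheses (S1 : S 1) (SM : forall a b, S a -> S b -> S (a * b)).
Hypothesis phiM : forall a b, S a -> S b -> phi (a * b) = phi a + phi b.

Lemma character1 : phi 1 = 0.
Proof.
by have := phiM S1 S1; rewrite mulr1 => h; apply: (addrI (phi 1)); rewrite addr0.
Qed.

Lemma characterX (a : int) (e : 'F_2) : S a -> S (a ^+ e) /\ phi (a ^+ e) = e * phi a.
Proof.
move=> Sa; case: (F2P e) => ->; first by rewrite expr0 mul0r character1.
by rewrite expr1 mul1r.
Qed.

Lemma character_prod (I : finType) (P : pred I) (f : I -> int) :
  (forall i, P i -> S (f i)) ->
  S (\prod_(i | P i) f i) /\ phi (\prod_(i | P i) f i) = \sum_(i | P i) phi (f i).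
Proof.
move=> Sf; apply: (big_ind2 (fun a b => S a /\ phi a = b)).
- by rewrite character1.
- by move=> a b c d [Sa <-] [Sc <-]; split; [exact: SM|exact: phiM].
- by move=> i Pi; split; first exact: Sf.
Qed.

Lemma character_prodX (I : finType) (P : pred I) (f : I -> int) (e : I -> 'F_2) :
  (forall i, P i -> S (f i)) ->
  S (\prod_(i | P i) f i ^+ e i) /\
  phi (\prod_(i | P i) f i ^+ e i) = \sum_(i | P i) e i * phi (f i).
Proof.
move=> Sf; have [|h1 ->] := @character_prod I P (fun i => f i ^+ e i).
  by move=> i Pi; have [] := characterX (e i) (Sf i Pi).
split=> //; apply: eq_bigr => i Pi.
by have [] := characterX (e i) (Sf i Pi).
Qed.

Lemma characterM3 a b c d (e1 e2 e3 : 'F_2) : S a -> S b -> S c -> S d ->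
  S (a ^+ e1 * b ^+ e2 * c ^+ e3 * d) /\
  phi (a ^+ e1 * b ^+ e2 * c ^+ e3 * d) = e1 * phi a + e2 * phi b + e3 * phi c + phi d.
Proof.
move=> Sa Sb Sc Sd; have [Ha ha] := characterX e1 Sa; have [Hb hb] := characterX e2 Sb.
have [Hc hc] := characterX e3 Sc.
by rewrite !phiM ?ha ?hb ?hc; do ?split; do ?apply: SM.
Qed.

End Character.

Lemma soluble2P (n c1 c2 : nat) (a1 a2 : 'F_2) : (n < 8)%N ->
  soluble2 n (a1 != 0) c1 (a2 != 0) c2 <->
  a1 = 0 /\ if n == 1%N then a2 + (is3mod4 c1)%:R = 0 /\
                            (is3mod4 c2)%:R + a2 + (is35mod8 c1)%:R = 0
            else if n == 5%N then a2 = 0 /\ (is3mod4 c1)%:R = 0 :> 'F_2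
            else a2 = 0 /\ (is3mod4 c2)%:R = 0 :> 'F_2.
Proof.
move=> n8; rewrite /soluble2 modn_small //.
case: (F2P a1) => ->; case: (F2P a2) => -> /=; do ?case: ifP => _;
  case: (is3mod4 c1); case: (is3mod4 c2); case: (is35mod8 c1); split => //;
  solve [by do ?split; apply/eqP | by case=> /eqP | by case=> _ [/eqP] | by case=> _ [_ /eqP]].
Qed.

Section LocalSystem.
Variables (t : nat) (p : 'I_t -> nat).
Hypotheses (p_prime : forall i, prime (p i)) (p_neq2 : forall i, p i <> 2%N)
  (p_neq3 : forall i, p i <> 3%N) (p_inj : injective p).

(** The integer behind both [decode1] and [decode2]. *)
Definition encoded (e1 e2 e3 : 'F_2) (e : 'I_t -> 'F_2) : int :=
  (-1) ^+ e1 * 2 ^+ e2 * 3 ^+ e3 * \prod_i (p i)%:Z ^+ e i.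

Local Notation nt := (\prod_i (p i)%:Z).
Local Notation n := (3 * nt).

Lemma p_odd i : odd (p i).
Proof. by case: (even_prime (p_prime i)) => // /p_neq2. Qed.

Lemma dvdz_primes (l : nat) (pl : prime l) i : (l %| (p i)%:Z)%Z = (l == p i).
Proof. by rewrite dvdzE /= dvdn_prime2. Qed.

Section Exponents.
Variables (s1 a1 c1 s2 a2 c2 : 'F_2) (x y : 'I_t -> 'F_2).
Local Notation b1 := (encoded s1 a1 c1 x).
Local Notation b2 := (encoded s2 a2 c2 y).

Lemma encoded_neq0 e1 e2 e3 e : encoded e1 e2 e3 e != 0.
Proof.
rewrite /encoded !mulf_neq0 ?expf_neq0 //.
by apply/prodf_neq0 => i _; rewrite expf_neq0 // eqz_nat -lt0n prime_gt0.
Qed.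

Lemma nt_gt0 : 0 < nt.
Proof. by apply: prodr_gt0 => i _; rewrite ltz_nat prime_gt0. Qed.

Lemma encoded_gt0 e1 e2 e3 e : (0 < encoded e1 e2 e3 e) = (e1 == 0).
Proof.
have h : 0 < 2 ^+ e2 * 3 ^+ e3 * \prod_i (p i)%:Z ^+ e i :> int.
  rewrite !mulr_gt0 ?exprn_gt0 //; apply: prodr_gt0 => i _.
  by rewrite exprn_gt0 // ltz_nat prime_gt0.
rewrite /encoded -2!mulrA [X in (_ * X)]mulrA; case: (F2P e1) => ->.
  by rewrite expr0 mul1r h.
by rewrite expr1 mulN1r oppr_gt0 ltNge (ltW h).
Qed.

Lemma local_real :
  cov (n%:~R : Rdefinitions.R) b1%:~R b2%:~R <-> s2 + s1 = 0.
Proof.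
have n0 : 0 < n%:~R :> Rdefinitions.R by rewrite ltr0z pmulr_rgt0 // nt_gt0.
rewrite cov_realP ?intr_eq0 ?encoded_neq0 // !ltr0z !encoded_gt0.
 case: (F2P s1) => ->; case: (F2P s2) => ->; split=> h; solve [by apply/eqP | by move/eqP: h].

Qed.

Local Notation legn a l := (add_legendre a l).

(** With the factor [p i] removed, n becomes 3 times the product of the other primes. The symbols of
    this number and of its opposite are the diagonal entries of A + D_3 and A + D_{-3}. *)
Lemma local_prime (q : prime_nat) (i : 'I_t) : q = p i :> nat ->
  cov (n%:~R : Qp q) b1%:~R b2%:~R <->
  s2 * legn (-1) q + a2 * legn 2 q + c2 * legn 3 q + \sum_(j | j != i) y j * legn (p j) q
    + y i * (legn (-3) q + \sum_(j | j != i) legn (p j) q) = 0 /\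
  s1 * legn (-1) q + a1 * legn 2 q + c1 * legn 3 q + \sum_(j | j != i) x j * legn (p j) q
    + x i * (legn 3 q + \sum_(j | j != i) legn (p j) q) + y i * legn (-3) q = 0.
Proof.
move=> qi; have q_odd : odd q by rewrite qi p_odd.
have q_pr := primeP q.
pose S a := ~~ (q %| a)%Z.
have q2 : S 2 by rewrite /S dvdzE /= dvdn_prime2 // qi; apply/eqP/p_neq2.
have q3 : S 3 by rewrite /S dvdzE /= dvdn_prime2 // qi; apply/eqP/p_neq3.
have qN1 : S (-1) by rewrite /S dvdzE /= dvdn1; have := prime_gt1 q_pr; lia.
have q1 : S 1 := qN1.
have SM a b : S a -> S b -> S (a * b).
  by rewrite /S => ha hb; rewrite prime_dvdzM negb_or ha.
have qp j : j != i -> S (p j)%:Z.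
  by move=> ji; rewrite /S dvdz_primes // qi; apply: contra ji => /eqP /p_inj ->.
have legM a b : S a -> S b -> legn (a * b) q = legn a q + legn b q.
  exact: add_legendreM.
have [Sm legm] := character_prod q1 SM legM qp.
have split_encoded e1 e2 e3 e : encoded e1 e2 e3 e =
    q%:Z ^+ e i * ((-1) ^+ e1 * 2 ^+ e2 * 3 ^+ e3 * \prod_(j | j != i) (p j)%:Z ^+ e j).
  by rewrite /encoded (bigD1 i) //= -qi; ring.
have unit_part e1 e2 e3 e := characterM3 q1 SM legM e1 e2 e3 qN1 q2 q3
  (character_prodX q1 SM legM e qp).1.
have -> : n = q%:Z * (3 * \prod_(j | j != i) (p j)%:Z) by rewrite (bigD1 i) //= -qi; ring.
rewrite !split_encoded cov_ramifiedP //; first last.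
- by case: (unit_part s2 a2 c2 y).
- by case: (unit_part s1 a1 c1 x).
- exact: SM.
rewrite (unit_part s2 a2 c2 y).2 (unit_part s1 a1 c1 x).2.
rewrite !(character_prodX q1 SM legM _ qp).2.
have -> : legn (- (3 * \prod_(j | j != i) (p j)%:Z)) q
    = legn (-3) q + \sum_(j | j != i) legn (p j) q.
  by rewrite -mulNr -legm; exact: (legM _ _ (q3 : S (-3)) Sm).
by rewrite legM // legm.
Qed.

Local Notation e := (add_legendre_prod p (-3)).

(** Both -1 and 2 are nonsquares modulo 3, hence the coefficients 1; reciprocity turns the symbol of
    [p i] at 3 into that of -3 at [p i]. *)
Lemma local_3 (q : prime_nat) : q = 3%N :> nat ->
  cov (n%:~R : Qp q) b1%:~R b2%:~R <->
  s2 + a2 + (1 + e) * c2 + \sum_i y i * legn (-3) (p i) = 0 /\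
  (1 + e) * c2 + s1 + a1 + e * c1 + \sum_i x i * legn (-3) (p i) = 0.
Proof.
move=> q3; have q_odd : odd q by rewrite q3.
have q_pr := primeP q.
pose S a := ~~ (q %| a)%Z.
have q2 : S 2 by rewrite /S q3.
have qN1 : S (-1) by rewrite /S q3.
have q1 : S 1 := qN1.
have SM a b : S a -> S b -> S (a * b).
  by rewrite /S => ha hb; rewrite prime_dvdzM negb_or ha.
have qp j : true -> S (p j)%:Z.
  by move=> _; rewrite /S dvdz_primes // q3; apply/eqP => /esym /p_neq3.
have legM a b : S a -> S b -> legn (a * b) q = legn a q + legn b q.
  exact: add_legendreM.
have [Sm legm] := character_prod q1 SM legM qp.
(* The power of 3 is taken out and replaced by a power of 1, so that the unit part keeps the shape
   that [characterM3] expects. *)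
have split_encoded e1 e2 e3 e : encoded e1 e2 e3 e =
    q%:Z ^+ e3 * ((-1) ^+ e1 * 2 ^+ e2 * 1 ^+ e3 * \prod_j (p j)%:Z ^+ e j).
  by rewrite /encoded q3 expr1n; ring.
have unit_part e1 e2 e3 e := characterM3 q1 SM legM e1 e2 e3 qN1 q2 q1
  (character_prodX q1 SM legM e qp).1.
have -> : n = q%:Z * nt by rewrite q3.
rewrite !split_encoded cov_at3P //; first last.
- by case: (unit_part s2 a2 c2 y).
- by case: (unit_part s1 a1 c1 x).
rewrite (unit_part s2 a2 c2 y).2 (unit_part s1 a1 c1 x).2.
rewrite !(character_prodX q1 SM legM _ qp).2.
have legN1 : legn (-1) q = 1 by rewrite add_legendreN1 // q3.
have leg2 : legn 2 q = 1 by rewrite add_legendre2 // q3.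
have leg1 : legn 1 q = 0 by apply: (character1 q1 legM).
have legp j : legn (p j) q = legn (-3) (p j).
  by rewrite q3 add_legendre_3 ?p_odd //; apply/eqP/p_neq3.
have eE : legn nt q = e by rewrite legm; apply: eq_bigr.
have -> : legn (- nt) q = 1 + e.
  rewrite -eE -legN1; have -> : - nt = -1 * nt by rewrite mulN1r.
  exact: (legM _ _ qN1 Sm).
rewrite eE legN1 leg2 leg1 !mulr1 !mulr0 !addr0.
have sumE (z : 'I_t -> 'F_2) : \sum_i z i * legn (p i) q = \sum_i z i * legn (-3) (p i).
  by apply: eq_bigr => i _; rewrite legp.
rewrite !sumE.
set X := \sum_i x i * _; set Y := \sum_i y i * _.
have -> : s2 + a2 + Y + c2 * (1 + e) = s2 + a2 + (1 + e) * c2 + Y by ring.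
have -> : s1 + a1 + X + c1 * e + c2 * (1 + e) = (1 + e) * c2 + s1 + a1 + e * c1 + X by ring.
by [].
Qed.

Lemma local_2 (q : prime_nat) : q = 2%N :> nat ->
  let X4 := s1 + c1 + \sum_i x i * legn (-1) (p i) in
  let Y4 := s2 + c2 + \sum_i y i * legn (-1) (p i) in
  let X8 := c1 + \sum_i x i * legn 2 (p i) in
  cov (n%:~R : Qp q) b1%:~R b2%:~R <->
  a1 = 0 /\ if `|(n %% 8)%Z|%N == 1%N then a2 + X4 = 0 /\ Y4 + a2 + X8 = 0
            else if `|(n %% 8)%Z|%N == 5%N then a2 = 0 /\ X4 = 0
            else a2 = 0 /\ Y4 = 0.
Proof.
move=> q2 X4 Y4 X8.
pose S (a : int) := odd `|a|.
have q1 : S 1 by [].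
have SM a b : S a -> S b -> S (a * b) by rewrite /S abszM oddM => -> ->.
have qp j : true -> S (p j)%:Z by move=> _; exact: p_odd.
(* As at 3, the extracted power of 2 leaves a power of 1 in its place. *)
have split_encoded e1 e2 e3 e : encoded e1 e2 e3 e =
    2 ^+ (e2 != 0) * ((-1) ^+ e1 * 1 ^+ e2 * 3 ^+ e3 * \prod_j (p j)%:Z ^+ e j).
  by rewrite /encoded -F2_nat_of_ord expr1n; ring.
have chi4p j : chi4 (p j) = legn (-1) (p j).
  by rewrite add_legendreN1 ?p_odd // /chi4 /is3mod4; congr (nat_of_bool _)%:R; lia.
have chi8p j : chi8 (p j) = legn 2 (p j).
  rewrite add_legendre2 ?p_odd // /chi8 /is35mod8; congr (nat_of_bool _)%:R.
  by rewrite modz_nat /= modn_mod.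
have unit4 e1 e2 e3 e := characterM3 q1 SM chi4M e1 e2 e3 (isT : S (-1)) q1 (isT : S 3)
  (character_prodX q1 SM chi4M e qp).1.
have unit8 e1 e2 e3 e := characterM3 q1 SM chi8M e1 e2 e3 (isT : S (-1)) q1 (isT : S 3)
  (character_prodX q1 SM chi8M e qp).1.
have Snt : S nt by have [] := character_prod q1 SM chi4M qp.
rewrite !split_encoded cov_at2P //; first last.
- by case: (unit4 s2 a2 c2 y).
- by case: (unit4 s1 a1 c1 x).
- exact: SM.
set u1 := _ * \prod_j _ ^+ x j; set u2 := _ * \prod_j _ ^+ y j.
have X4E : (is3mod4 `|(u1 %% 8)%Z|)%:R = X4.
  rewrite -/(chi4 u1) (unit4 s1 a1 c1 x).2 (character_prodX q1 SM chi4M x qp).2.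
  under eq_bigr do rewrite chi4p.
  have -> : chi4 (-1) = 1 by []. have -> : chi4 1 = 0 by []. have -> : chi4 3 = 1 by [].
  by rewrite !mulr1 mulr0 addr0.
have Y4E : (is3mod4 `|(u2 %% 8)%Z|)%:R = Y4.
  rewrite -/(chi4 u2) (unit4 s2 a2 c2 y).2 (character_prodX q1 SM chi4M y qp).2.
  under eq_bigr do rewrite chi4p.
  have -> : chi4 (-1) = 1 by []. have -> : chi4 1 = 0 by []. have -> : chi4 3 = 1 by [].
  by rewrite !mulr1 mulr0 addr0.
have X8E : (is35mod8 `|(u1 %% 8)%Z|)%:R = X8.
  rewrite -/(chi8 u1) (unit8 s1 a1 c1 x).2 (character_prodX q1 SM chi8M x qp).2.
  under eq_bigr do rewrite chi8p.
  have -> : chi8 (-1) = 0 by []. have -> : chi8 1 = 0 by []. have -> : chi8 3 = 1 by [].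
  by rewrite !mulr1 !mulr0 !add0r.
rewrite -X4E -Y4E -X8E; apply: soluble2P; lia.
Qed.

End Exponents.
End LocalSystem.

(** * Everywhere local solubility *)

Section Selmer.
Variables (t : nat) (p : 'I_t -> nat).
Hypotheses (p_prime : forall i, prime (p i)) (p_neq2 : forall i, p i <> 2%N)
  (p_neq3 : forall i, p i <> 3%N) (p_inj : injective p).

Local Notation nt := (\prod_i (p i)%:Z).
Local Notation n := (3 * nt).
Local Notation e := (add_legendre_prod p (-3)).
Local Notation leg a l := (add_legendre a l).

(** The primes not dividing any of the differences n, 3n and 4n of the roots. *)
Definition good_prime (q : nat) := [&& prime q, q != 2%N, q != 3%N & [forall i, q != p i]].

Lemma good_prime_dvdz (q : nat) : good_prime q ->
  [/\ prime q, odd q, ~~ (q %| 3)%Z, ~~ (q %| n)%Z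
    & forall e1 e2 e3 e', ~~ (q %| encoded p e1 e2 e3 e')%Z].
Proof.
move=> /and4P[q_pr q2 q3 /forallP qp].
have q_odd : odd q by case: (even_prime q_pr) => // /eqP; rewrite (negPf q2).
pose Q := PrimeNat q_pr; pose S a := ~~ (q %| a)%Z.
have q1 : S 1 by rewrite /S dvdzE /= dvdn1 gtn_eqF // prime_gt1.
have SM a b : S a -> S b -> S (a * b).
  by rewrite /S => ha hb; rewrite (@prime_dvdzM Q) negb_or ha.
have S2 : S 2 by rewrite /S dvdzE /= dvdn_prime2.
have S3 : S 3 by rewrite /S dvdzE /= dvdn_prime2.
have Sp i : true -> S (p i)%:Z by move=> _; rewrite /S dvdz_primes.
have legM a b : S a -> S b -> leg (a * b) q = leg a q + leg b q.
  exact: add_legendreM.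
have [Sn _] := character_prod q1 SM legM Sp.
split=> //; first exact: SM.
move=> e1 e2 e3 e'.
by have [] := characterM3 q1 SM legM e1 e2 e3 (q1 : S (-1)) S2 S3
  (character_prodX q1 SM legM e' Sp).1.
Qed.

Lemma locally_solubleP (s1 a1 c1 s2 a2 c2 : 'F_2) (x y : 'I_t -> 'F_2) :
  let X4 := s1 + c1 + \sum_i x i * leg (-1) (p i) in
  let Y4 := s2 + c2 + \sum_i y i * leg (-1) (p i) in
  let X8 := c1 + \sum_i x i * leg 2 (p i) in
  locally_soluble n (encoded p s1 a1 c1 x) (encoded p s2 a2 c2 y) <->
  [/\ s2 + s1 = 0,
      a1 = 0 /\ (if `|(n %% 8)%Z|%N == 1%N then a2 + X4 = 0 /\ Y4 + a2 + X8 = 0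
            else if `|(n %% 8)%Z|%N == 5%N then a2 = 0 /\ X4 = 0
            else a2 = 0 /\ Y4 = 0),
      s2 + a2 + (1 + e) * c2 + \sum_i y i * leg (-3) (p i) = 0,
      (1 + e) * c2 + s1 + a1 + e * c1 + \sum_i x i * leg (-3) (p i) = 0
    & forall i,
      s2 * leg (-1) (p i) + a2 * leg 2 (p i) + c2 * leg 3 (p i)
        + \sum_(j | j != i) y j * leg (p j) (p i)
        + y i * (leg (-3) (p i) + \sum_(j | j != i) leg (p j) (p i)) = 0 /\
      s1 * leg (-1) (p i) + a1 * leg 2 (p i) + c1 * leg 3 (p i)
        + \sum_(j | j != i) x j * leg (p j) (p i)
        + x i * (leg 3 (p i) + \sum_(j | j != i) leg (p j) (p i))
        + y i * leg (-3) (p i) = 0].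
Proof.
move=> X4 Y4 X8; split.
  move=> [hR hp].
  have h2 := hp (PrimeNat (isT : prime 2)); have h3 := hp (PrimeNat (isT : prime 3)).
  move: hR h2 h3 => /(local_real p_prime) hR /(local_2 p_prime p_neq2)-/(_ erefl) h2.
  move=> /(local_3 p_prime p_neq2 p_neq3)-/(_ erefl)[h3 h3'].
  split=> // i.
  exact/(@local_prime _ _ p_prime p_neq2 p_neq3 p_inj _ _ _ _ _ _ _ _
    (PrimeNat (p_prime i)) i erefl)/hp.
move=> [hR h2 h3 h3' hp]; split; first exact/local_real.
move=> q; have q_pr := primeP q.
have [E|q2] := eqVneq (q : nat) 2%N; first by apply/(local_2 p_prime p_neq2).
have [E|q3] := eqVneq (q : nat) 3%N; first by apply/(local_3 p_prime p_neq2 p_neq3).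
have [/existsP[i /eqP qi]|] := boolP [exists i, (q : nat) == p i].
  by apply/(local_prime p_prime p_neq2 p_neq3 p_inj _ _ _ _ _ _ _ _ qi); rewrite qi.
rewrite negb_exists => qp.
have [|_ q_odd n3 nn nenc] := @good_prime_dvdz q; first by rewrite /good_prime q_pr q2 q3.
exact: cov_good.
Qed.

(** For squarefree representatives, solubility leaves only -1, 2, 3 and the [p i] as possible
    factors; the encoding is surjective for this reason. *)
Lemma unramified (q : nat) (m1 m2 : int) : good_prime q -> m1 != 0 -> m2 != 0 ->
  (logn q `|m1| <= 1)%N -> (logn q `|m2| <= 1)%N -> locally_soluble n m1 m2 ->
  ~~ (q %| m1)%Z && ~~ (q %| m2)%Z.
Proof.
move=> /good_prime_dvdz[q_pr q_odd n3 nn _] m10 m20 l1 l2 [_ /(_ (PrimeNat q_pr)) h].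
have split_q (m : int) : m != 0 -> (logn q `|m| <= 1)%N ->
    ~~ (q %| m)%Z \/ exists2 m', m = q%:Z * m' & ~~ (q %| m')%Z.
  move=> m0 lm; have [/dvdzP[m' mE]|] := boolP (q %| m)%Z; last by left.
  right; exists m'; first by rewrite mulrC.
  apply: contraL lm => /dvdzP[m'' mE']; rewrite -ltnNge.
  rewrite -[(1 < _)%N]/(2 <= _)%N -pfactor_dvdn ?absz_gt0 // mE mE' -mulrA abszM.
  by rewrite dvdn_mull // abszM.
have n2 : ~~ (q %| 2)%Z by apply: (@prime_dvdz2 (PrimeNat q_pr)).
case: (split_q m1 m10 l1) (split_q m2 m20 l2) h
  => [nm1 [nm2|[m2' -> nm2]]|[m1' -> nm1] [nm2|[m2' -> nm2]]] h.
- by rewrite nm1.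
- by case: (@not_cov_ramified2 (PrimeNat q_pr) n m1 m2' nn nm1 nm2 n2).
- by case: (@not_cov_ramified1 (PrimeNat q_pr) n m1' m2 n3 nn nm1 nm2).
- by case: (@not_cov_ramified12 (PrimeNat q_pr) n m1' m2' nn nm1 nm2).
Qed.

End Selmer.

(** * The encoding of Selmer elements *)

Section Encoding.
Variables (t : nat) (p : 'I_t -> nat).
Hypotheses (p_prime : forall i, prime (p i)) (p_neq2 : forall i, p i <> 2%N)
  (p_neq3 : forall i, p i <> 3%N) (p_inj : injective p).

Lemma logn_absz_encoded (l : nat) e1 e2 e3 e : prime l ->
  logn l `|encoded p e1 e2 e3 e| =
    ((l == 2) * e2 + (l == 3) * e3 + \sum_i (l == p i) * e i)%N.
Proof.
move=> pl; rewrite /encoded !abszM !abszX /= exp1n mul1n.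
have -> : `|(\prod_i (p i)%:Z ^+ e i)%R|%N = (\prod_i p i ^ e i)%N.
  elim/big_rec2: _ => // i a b _ <-; by rewrite abszM abszX.
rewrite !lognM ?muln_gt0 ?expn_gt0 //; last first.
  by apply: prodn_gt0 => i; rewrite expn_gt0 prime_gt0.
rewrite !lognX (@logn_prime l 2) // (@logn_prime l 3) //.
have -> : logn l (\prod_i p i ^ e i) = (\sum_i (l == p i) * e i)%N.
  have : (0 < \prod_i p i ^ e i)%N /\ logn l (\prod_i p i ^ e i) = (\sum_i (l == p i) * e i)%N.
    elim/big_rec2: _ => [|i a b _ [b0 <-]]; first by rewrite logn1.
    have p0 : (0 < p i ^ e i)%N by rewrite expn_gt0 prime_gt0.
    by rewrite muln_gt0 p0 b0 lognM // lognX logn_prime // mulnC.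
  by case.
by rewrite ![(_ * (l == _))%N]mulnC.
Qed.

Lemma logn_encoded2 e1 e2 e3 e : logn 2 `|encoded p e1 e2 e3 e| = e2.
Proof.
rewrite logn_absz_encoded //= mul1n addn0 big1 ?addn0 // => i _.
by case: eqP => // /esym /p_neq2.
Qed.

Lemma logn_encoded3 e1 e2 e3 e : logn 3 `|encoded p e1 e2 e3 e| = e3.
Proof.
rewrite logn_absz_encoded //= mul1n add0n big1 ?addn0 // => i _.
by case: eqP => // /esym /p_neq3.
Qed.

Lemma logn_encodedp e1 e2 e3 e i : logn (p i) `|encoded p e1 e2 e3 e| = e i.
Proof.
rewrite logn_absz_encoded // (bigD1 i) //= eqxx mul1n big1 ?addn0.
  by case: eqP => [/p_neq2//|_]; case: eqP => [/p_neq3//|_].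
by move=> j /negPf ji; rewrite (inj_eq p_inj) eq_sym ji.
Qed.

Lemma F2_nat_inj (a b : 'F_2) : a = b :> nat -> a = b.
Proof. by move=> h; apply/val_inj. Qed.

Lemma odd_logn_mul_sqr (l m k : nat) : (0 < m)%N -> (0 < k)%N ->
  odd (logn l (m * k ^ 2)) = odd (logn l m).
Proof. by move=> m0 k0; rewrite lognM ?expn_gt0 ?k0 // lognX mul2n oddD odd_double addbF. Qed.

Lemma F2_odd (a : 'F_2) : (odd a : nat) = a.
Proof. by case: (F2P a) => ->. Qed.

(** The sign and the parities of the valuations are invariants of a square class, and they give back
    all the exponents. *)
Lemma encoded_sqclass_inj e1 e2 e3 e e1' e2' e3' e' :
  sqclass (encoded p e1 e2 e3 e)%:~R = sqclass (encoded p e1' e2' e3' e')%:~R ->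
  [/\ e1 = e1', e2 = e2', e3 = e3' & e =1 e'].
Proof.
set a := encoded p e1 e2 e3 e; set b := encoded p e1' e2' e3' e'.
move=> ab; have : sqclass a%:~R a%:~R.
  by exists 1; rewrite ?oner_neq0 // expr1n mulr1.
rewrite ab => -[r r0 E].
have a0 : a != 0 by exact: encoded_neq0. have b0 : b != 0 by exact: encoded_neq0.
have {E} E : a * denq r ^+ 2 = b * numq r ^+ 2.
  apply: (@intr_inj rat); rewrite [LHS]intrM [RHS]intrM E -{1}(divq_num_den r) !rmorphXn /=.
  by field; rewrite intr_eq0 denq_neq0.
have nr0 : (0 < `|numq r|)%N by rewrite absz_gt0 numq_eq0.
have dr0 : (0 < `|denq r|)%N by rewrite absz_gt0 denq_neq0.
have par l : odd (logn l `|a|) = odd (logn l `|b|).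
  rewrite -(@odd_logn_mul_sqr l `|a| `|denq r|) ?absz_gt0 ?denq_neq0 //.
  by rewrite -abszX -abszM E abszM abszX odd_logn_mul_sqr ?absz_gt0 ?numq_eq0.
split.
- have : (0 < a) = (0 < b).
    have n2 : 0 < numq r ^+ 2 by rewrite exprn_even_gt0 //= numq_eq0.
    have d2 : 0 < denq r ^+ 2 by rewrite exprn_gt0.
    by rewrite -(pmulr_lgt0 a d2) E pmulr_lgt0.
  rewrite !encoded_gt0 //.
  by case: (F2P e1) => ->; case: (F2P e1') => ->.
- apply: F2_nat_inj; rewrite -F2_odd -[RHS]F2_odd.
  by rewrite -(logn_encoded2 e1 e2 e3 e) -(logn_encoded2 e1' e2' e3' e') par.
- apply: F2_nat_inj; rewrite -F2_odd -[RHS]F2_odd.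
  by rewrite -(logn_encoded3 e1 e2 e3 e) -(logn_encoded3 e1' e2' e3' e') par.
- move=> i; apply: F2_nat_inj; rewrite -F2_odd -[RHS]F2_odd.
  by rewrite -(logn_encodedp e1 e2 e3 e) -(logn_encodedp e1' e2' e3' e') par.
Qed.

(** The exponents are the valuations, which are 0 or 1; two integers with the same sign and the same
    valuation at every prime are equal. *)
Lemma encoded_of_squarefree (s : nat) (e : bool) : (0 < s)%N ->
  (forall l, logn l s <= 1)%N -> (forall l, good_prime p l -> ~~ (l %| s)%N) ->
  exists e1 e2 e3 e', (-1) ^+ e * s%:Z = encoded p e1 e2 e3 e'.
Proof.
move=> s0 s1 sg; pose f (l : nat) : 'F_2 := (logn l s)%:R.
have fE l : (f l : nat) = logn l s.
  by rewrite /f; have := s1 l; case: (logn l s) => [|[|//]].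
exists e%:R, (f 2), (f 3), (fun i => f (p i)).
have Egt := encoded_gt0 p_prime e%:R (f 2) (f 3) (fun i => f (p i)).
have En0 := encoded_neq0 p_prime e%:R (f 2) (f 3) (fun i => f (p i)).
have L2 := logn_encoded2 e%:R (f 2) (f 3) (fun i => f (p i)).
have L3 := logn_encoded3 e%:R (f 2) (f 3) (fun i => f (p i)).
have Lp := logn_encodedp e%:R (f 2) (f 3) (fun i => f (p i)).
have L l := @logn_absz_encoded l e%:R (f 2) (f 3) (fun i => f (p i)).
move: (encoded p _ _ _ _) Egt En0 L2 L3 Lp L => E Egt En0 L2 L3 Lp L.
have -> : E = (-1) ^+ e * `|E|%N%:Z.
  rewrite {1}[E]intEsign; congr ((-1) ^+ nat_of_bool _ * _).
  by move: En0 Egt; case: ltrgtP => // _ _ /esym; case: e.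
congr (_ * Posz _); apply: eqn_from_log; rewrite ?absz_gt0 //.
move=> l; have [pl|npl] := boolP (prime l); last by rewrite lognE [RHS]lognE (negPf npl).
have [->|l2] := eqVneq l 2%N; first by rewrite L2 fE.
have [->|l3] := eqVneq l 3%N; first by rewrite L3 fE.
have [/existsP[i /eqP ->]|] := boolP [exists i, l == p i]; first by rewrite Lp fE.
rewrite negb_exists => lp; have : good_prime p l by rewrite /good_prime pl l2 l3.
move/sg => ls; rewrite L // (negPf l2) (negPf l3) big1.
  by apply/eqP; rewrite -leqn0 leqNgt logn_gt0 mem_primes pl s0.
by move=> i _; move/forallP: lp => /(_ i) /negPf ->.
Qed.

Lemma sqclass_mul_sqr (b r : rat) : r != 0 -> sqclass (b * r ^+ 2) = sqclass b.
Proof.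
move=> r0; apply/seteqP; split=> c [s s0 ->].
  by exists (r * s); [rewrite mulf_neq0|ring].
exists (s / r); first by rewrite mulf_neq0 ?invr_eq0.
by field.
Qed.

Local Notation n := (3 * \prod_i (p i)%:Z).

Section Vector.
Variable v : 'cV['F_2]_(6 + (t + t)).
Definition head_coord (k : nat) : 'F_2 := usubmx v (inord k) 0.
Definition y_coord (i : 'I_t) : 'F_2 := usubmx (dsubmx v) i 0.
Definition x_coord (i : 'I_t) : 'F_2 := dsubmx (dsubmx v) i 0.
Definition encoded1 := encoded p (head_coord 3) (head_coord 4) (head_coord 5) x_coord.
Definition encoded2 := encoded p (head_coord 0) (head_coord 1) (head_coord 2) y_coord.

Lemma decode1E : decode1 p v = encoded1%:~R.
Proof.
rewrite /decode1 /encoded1 /encoded !intrM !rmorphXn rmorph_prod /=.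
congr (_ * _ * _ * _); apply: eq_bigr => i _; by rewrite rmorphXn.
Qed.

Lemma decode2E : decode2 p v = encoded2%:~R.
Proof.
rewrite /decode2 /encoded2 /encoded !intrM !rmorphXn rmorph_prod /=.
congr (_ * _ * _ * _); apply: eq_bigr => i _; by rewrite rmorphXn.
Qed.
End Vector.

Lemma coord_eq v w : (forall k, (k < 6)%N -> head_coord v k = head_coord w k) ->
  y_coord v =1 y_coord w -> x_coord v =1 x_coord w -> v = w.
Proof.
move=> h hy hx; rewrite -[v]vsubmxK -[w]vsubmxK; congr col_mx.
  by apply/colP => i; have := h i (ltn_ord i); rewrite /head_coord inord_val.
rewrite -[dsubmx v]vsubmxK -[dsubmx w]vsubmxK.
by congr col_mx; apply/colP => i; [exact: hy|exact: hx].
Qed.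

Lemma exists_coord (h : nat -> 'F_2) (y x : 'I_t -> 'F_2) :
  exists v, [/\ forall k, (k < 6)%N -> head_coord v k = h k,
    y_coord v =1 y & x_coord v =1 x].
Proof.
exists (col_mx (\col_i h i) (col_mx (\col_i y i) (\col_i x i))).
rewrite /head_coord /y_coord /x_coord; split=> [k k6|i|i].
- by rewrite col_mxKu mxE inordK.
- by rewrite col_mxKd col_mxKu mxE.
- by rewrite !col_mxKd mxE.
Qed.

Lemma Monsky_of_locally_soluble m (M : 'M['F_2]_(m, 6 + (t + t))) :
  (forall v, M *m v = 0 <-> locally_soluble n (encoded1 v) (encoded2 v)) ->
  is_Monsky_matrix p n M.
Proof.
move=> MP; split.
- move=> v /MP sol; exists (decode1 p v), (decode2 p v).
  rewrite /decode decode1E decode2E; split=> //; try by rewrite intr_eq0 encoded_neq0.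
  have := @everywhere_locally_solubleP n (encoded1 v) (encoded2 v) 1 1 (oner_neq0 _) (oner_neq0 _).
  by rewrite expr1n !mulr1 => h; apply/h.
- move=> v w _ _ [] /=; rewrite !decode1E !decode2E.
  move=> /encoded_sqclass_inj[h3 h4 h5 hx] /encoded_sqclass_inj[h0 h1 h2 hy].
  by apply: coord_eq => // -[|[|[|[|[|[|k]]]]]].
(* Surjectivity: a rational pair is replaced by its signed squarefree parts, whose exponents form
   the vector. *)
- move=> _ [b1 [b2 [b10 b20 els ->]]].
  have [s1 [e1 [r1 [r10 s10 E1 l1]]]] := squarefree_part_rat b10.
  have [s2 [e2 [r2 [r20 s20 E2 l2]]]] := squarefree_part_rat b20.
  have sol : locally_soluble n ((-1) ^+ e1 * s1%:Z) ((-1) ^+ e2 * s2%:Z).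
    by apply/(everywhere_locally_solubleP _ _ _ r10 r20); rewrite -E1 -E2.
  have nz (e : bool) s : (0 < s)%N -> (-1) ^+ e * s%:Z != 0.
    by move=> s0; rewrite mulf_neq0 ?signr_eq0 // eqz_nat -lt0n.
  have ab (e : bool) (s : nat) : `|((-1) ^+ e * s%:Z)%R|%N = s by rewrite abszMsign.
  have gp l : good_prime p l -> ~~ (l %| s1)%N && ~~ (l %| s2)%N.
    move=> gl; have := unramified p_prime gl (nz e1 s1 s10) (nz e2 s2 s20).
    by rewrite !ab !dvdzE !ab; apply.
  have [|f1 [f2 [f3 [f F1]]]] := encoded_of_squarefree e1 s10 l1.
    by move=> l /gp /andP[].
  have [|g1 [g2 [g3 [g G1]]]] := encoded_of_squarefree e2 s20 l2.
    by move=> l /gp /andP[].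
  have [v [vh vy vx]] := exists_coord (fun k => [:: g1; g2; g3; f1; f2; f3]`_k) g f.
  have V1 : encoded1 v = (-1) ^+ e1 * s1%:Z.
    rewrite F1 /encoded1 !vh //=; congr (_ * _); apply: eq_bigr => i _; by rewrite vx.
  have V2 : encoded2 v = (-1) ^+ e2 * s2%:Z.
    rewrite G1 /encoded2 !vh //=; congr (_ * _); apply: eq_bigr => i _; by rewrite vy.
  exists v; first by apply/MP; rewrite V1 V2.
  by rewrite /decode decode1E decode2E V1 V2 E1 E2 !sqclass_mul_sqr.
Qed.

End Encoding.

(** * The rows of the Monsky matrices *)

Section Rows.
Variables (t : nat) (p : 'I_t -> nat).
Hypotheses (p_prime : forall i, prime (p i)) (p_neq2 : forall i, p i <> 2%N)
  (p_neq3 : forall i, p i <> 3%N) (p_inj : injective p).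
Variable v : 'cV['F_2]_(6 + (t + t)).

Local Notation nt := (\prod_i (p i)%:Z).
Local Notation n := (3 * nt).
Local Notation e := (add_legendre_prod p (-3)).
Local Notation leg a l := (add_legendre a l).
Local Notation h := (head_coord v).
Local Notation x := (x_coord v).
Local Notation y := (y_coord v).

Lemma sum_ord6 (F : nat -> 'F_2) :
  \sum_(j < 6) F j = F 0%N + F 1%N + F 2%N + F 3%N + F 4%N + F 5%N.
Proof. by rewrite !big_ord_recr big_ord0 /= add0r. Qed.

Lemma mxline_mul (s : seq 'F_2) (Y X : 'rV['F_2]_t) :
  (mxline s Y X *m v) 0 0 =
    s`_0 * h 0 + s`_1 * h 1 + s`_2 * h 2 + s`_3 * h 3 + s`_4 * h 4 + s`_5 * h 5
    + \sum_i Y 0 i * y i + \sum_i X 0 i * x i.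
Proof.
rewrite -[v in LHS]vsubmxK -[dsubmx v]vsubmxK !mul_row_col !mxE addrA.
congr (_ + _ + _); rewrite -(sum_ord6 (fun j => s`_j * h j)).
by apply: eq_bigr => j _; rewrite mxE /head_coord inord_val.
Qed.

Lemma mxband_mul (s : seq 'cV['F_2]_t) (Y X : 'M['F_2]_t) i :
  (mxband s Y X *m v) i 0 =
    s`_0 i 0 * h 0 + s`_1 i 0 * h 1 + s`_2 i 0 * h 2 + s`_3 i 0 * h 3
    + s`_4 i 0 * h 4 + s`_5 i 0 * h 5
    + \sum_j Y i j * y j + \sum_j X i j * x j.
Proof.
rewrite -[v in LHS]vsubmxK -[dsubmx v]vsubmxK !mul_row_col !mxE addrA.
congr (_ + _ + _); rewrite -(sum_ord6 (fun j => s`_j i 0 * h j)).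
by apply: eq_bigr => j _; rewrite mxE /head_coord inord_val.
Qed.

Lemma scalar_mx_eq0 (a : 'M['F_2]_1) : a = 0 <-> a 0 0 = 0.
Proof.
split=> [->|a0]; first by rewrite mxE.
by apply/matrixP => i j; rewrite !ord1 a0 mxE.
Qed.

Lemma col_eq0 (a : 'cV['F_2]_t) : a = 0 <-> forall i, a i 0 = 0.
Proof.
split=> [-> i|a0]; first by rewrite mxE.
by apply/colP => i; rewrite a0 mxE.
Qed.

Lemma col_mx_mul_eq0 m1 m2 (M : 'M['F_2]_(m1, 6 + (t + t))) (N : 'M_(m2, 6 + (t + t))) :
  col_mx M N *m v = 0 <-> M *m v = 0 /\ N *m v = 0.
Proof.
rewrite mul_col_mx; split=> [/eqP|[-> ->]]; last by rewrite col_mx0.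
by rewrite col_mx_eq0 => /andP[/eqP-> /eqP->].
Qed.

Lemma sum_A_D d (z : 'I_t -> 'F_2) i :
  \sum_j (A_ p + D_ p d) i j * z j =
  \sum_(j | j != i) z j * leg (p j) (p i)
  + z i * (leg d (p i) + \sum_(j | j != i) leg (p j) (p i)).
Proof.
rewrite (bigD1 i) //= addrC !mxE eqxx mulr1n; congr (_ + _).
  apply: eq_bigr => j ji; rewrite !mxE eq_sym (negPf ji) mulr0n addr0 mulrC //.
by rewrite mulrC [X in z i * X]addrC.
Qed.

Lemma sum_D d (z : 'I_t -> 'F_2) i : \sum_j (D_ p d) i j * z j = leg d (p i) * z i.
Proof.
rewrite (bigD1 i) //= big1 ?addr0 => [|j ji]; first by rewrite !mxE eqxx mulr1n.
by rewrite !mxE eq_sym (negPf ji) mulr0n mul0r.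
Qed.

Lemma sum_O1 (z : 'I_t -> 'F_2) : \sum_j (0 : 'rV['F_2]_t) 0 j * z j = 0.
Proof. by apply: big1 => j _; rewrite mxE mul0r. Qed.

Lemma sum_O (z : 'I_t -> 'F_2) i : \sum_j (0 : 'M['F_2]_t) i j * z j = 0.
Proof. by apply: big1 => j _; rewrite mxE mul0r. Qed.

Lemma sum_r d (z : 'I_t -> 'F_2) : \sum_j (r_ p d) 0 j * z j = \sum_j z j * leg d (p j).
Proof. by apply: eq_bigr => j _; rewrite mxE mulrC. Qed.

(** The rows common to the three matrices: the two conditions at 3, then those at the [p i]. The
    first band is the condition on b1 and the second the one on b2. *)
Lemma C_low_mul :
  C_low p *m v = 0 <->
  [/\ h 0 + h 1 + (1 + e) * h 2 + \sum_i y i * leg (-3) (p i) = 0,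
      (1 + e) * h 2 + h 3 + h 4 + e * h 5 + \sum_i x i * leg (-3) (p i) = 0
    & forall i,
      h 0 * leg (-1) (p i) + h 1 * leg 2 (p i) + h 2 * leg 3 (p i)
        + \sum_(j | j != i) y j * leg (p j) (p i)
        + y i * (leg (-3) (p i) + \sum_(j | j != i) leg (p j) (p i)) = 0 /\
      h 3 * leg (-1) (p i) + h 4 * leg 2 (p i) + h 5 * leg 3 (p i)
        + \sum_(j | j != i) x j * leg (p j) (p i)
        + x i * (leg 3 (p i) + \sum_(j | j != i) leg (p j) (p i))
        + y i * leg (-3) (p i) = 0].
Proof.
rewrite /C_low; do 3!rewrite col_mx_mul_eq0; rewrite !scalar_mx_eq0 !col_eq0 !mxline_mul.
rewrite /= sum_O1 sum_O1 !sum_r !mul0r !mul1r !addr0 !add0r.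
have band1 i : (mxband [:: 0; 0; 0; (r_ p (-1))^T; (r_ p 2)^T; (r_ p 3)^T]
      (D_ p (-3)) (A_ p + D_ p 3) *m v) i 0
  = h 3 * leg (-1) (p i) + h 4 * leg 2 (p i) + h 5 * leg 3 (p i)
        + \sum_(j | j != i) x j * leg (p j) (p i)
        + x i * (leg 3 (p i) + \sum_(j | j != i) leg (p j) (p i))
        + y i * leg (-3) (p i).
  by rewrite mxband_mul /= sum_A_D sum_D !mxE !mul0r; ring.
have band2 i : (mxband [:: (r_ p (-1))^T; (r_ p 2)^T; (r_ p 3)^T; 0; 0; 0]
      (A_ p + D_ p (-3)) 0 *m v) i 0
  = h 0 * leg (-1) (p i) + h 1 * leg 2 (p i) + h 2 * leg 3 (p i)
        + \sum_(j | j != i) y j * leg (p j) (p i)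
        + y i * (leg (-3) (p i) + \sum_(j | j != i) leg (p j) (p i)).
  by rewrite mxband_mul /= sum_A_D sum_O !mxE !mul0r; ring.
split.
  move=> [h1 [h2 [h3 h4]]]; split=> // i.
  by move: (h3 i) (h4 i); rewrite band1 band2.
by move=> [h1 h2 h3]; do !split=> //; move=> i; rewrite ?band1 ?band2; case: (h3 i).
Qed.

Lemma C_stack_mul l1 l2 l3 l4 :
  C_stack p l1 l2 l3 l4 *m v = 0 <->
  [/\ (l1 *m v) 0 0 = 0, (l2 *m v) 0 0 = 0, (l3 *m v) 0 0 = 0, (l4 *m v) 0 0 = 0
    & C_low p *m v = 0].
Proof.
(* The height 6 + (t + t) agrees with the nested sums of [col_mx] only by computation, so the blocks
   are named explicitly. *)
have H m1 m2 (M : 'M['F_2]_(m1, _)) (N : 'M_(m2, _)) := col_mx_mul_eq0 M N.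
split=> [E|[h1 h2 h3 h4 h5]].
  have [/scalar_mx_eq0 ? {}E] := iffLR (H 1%N _ l1 (col_mx l2 (col_mx l3 (col_mx l4 (C_low p))))) E.
  have [/scalar_mx_eq0 ? {}E] := iffLR (H 1%N _ l2 (col_mx l3 (col_mx l4 (C_low p)))) E.
  have [/scalar_mx_eq0 ? {}E] := iffLR (H 1%N _ l3 (col_mx l4 (C_low p))) E.
  by have [/scalar_mx_eq0 ? {}E] := iffLR (H 1%N _ l4 (C_low p)) E.
apply: (iffRL (H 1%N _ l1 (col_mx l2 (col_mx l3 (col_mx l4 (C_low p)))))).
split; first exact/scalar_mx_eq0.
do 2![apply: (iffRL (H 1%N _ _ (col_mx _ _))); split; first exact/scalar_mx_eq0].
by apply: (iffRL (H 1%N _ _ _)); split; first exact/scalar_mx_eq0.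
Qed.

Local Notation O := (0 : 'rV['F_2]_t).

Lemma row_real : (mxline [:: 1; 0; 0; 1; 0; 0] O O *m v) 0 0 = h 0 + h 3.
Proof. by rewrite mxline_mul /= !sum_O1; ring. Qed.

Lemma row_h4 : (mxline [:: 0; 0; 0; 0; 1; 0] O O *m v) 0 0 = h 4.
Proof. by rewrite mxline_mul /= !sum_O1; ring. Qed.

Lemma row_h1 : (mxline [:: 0; 1; 0; 0; 0; 0] O O *m v) 0 0 = h 1.
Proof. by rewrite mxline_mul /= !sum_O1; ring. Qed.

Local Notation X4 := (h 3 + h 5 + \sum_i x i * leg (-1) (p i)).
Local Notation Y4 := (h 0 + h 2 + \sum_i y i * leg (-1) (p i)).
Local Notation X8 := (h 5 + \sum_i x i * leg 2 (p i)).

Lemma row_X4 : (mxline [:: 0; 0; 0; 1; 0; 1] O (r_ p (-1)) *m v) 0 0 = X4.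
Proof. by rewrite mxline_mul /= !sum_O1 !sum_r; ring. Qed.

Lemma row_Y4 : (mxline [:: 1; 0; 1; 0; 0; 0] (r_ p (-1)) O *m v) 0 0 = Y4.
Proof. by rewrite mxline_mul /= !sum_O1 !sum_r; ring. Qed.

Lemma row_h1_X4 : (mxline [:: 0; 1; 0; 1; 0; 1] O (r_ p (-1)) *m v) 0 0 = h 1 + X4.
Proof. by rewrite mxline_mul /= !sum_O1 !sum_r; ring. Qed.

Lemma row_Y4_X8 :
  (mxline [:: 1; 1; 1; 0; 0; 1] (r_ p (-1)) (r_ p 2) *m v) 0 0 = Y4 + h 1 + X8.
Proof. by rewrite mxline_mul /= !sum_r; ring. Qed.

Lemma C1_mul : `|(n %% 8)%Z|%N = 1%N ->
  C1 p *m v = 0 <-> locally_soluble n (encoded1 p v) (encoded2 p v).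
Proof.
move=> n8; rewrite locally_solubleP // n8 /= C_stack_mul.
rewrite row_real row_h1_X4 row_h4 row_Y4_X8.
split=> [[? ? ? ? /C_low_mul[]]|[? [? []] ? ? ? ? ?]] //.
by split=> //; apply/C_low_mul.
Qed.

Lemma C2_mul : `|(n %% 8)%Z|%N = 5%N ->
  C2 p *m v = 0 <-> locally_soluble n (encoded1 p v) (encoded2 p v).
Proof.
move=> n8; rewrite locally_solubleP // n8 /= C_stack_mul.
rewrite row_real row_h4 row_h1 row_X4.
split=> [[? ? ? ? /C_low_mul[]]|[? [? []] ? ? ? ? ?]] //.
by split=> //; apply/C_low_mul.
Qed.

Lemma C3_mul : `|(n %% 8)%Z|%N != 1%N -> `|(n %% 8)%Z|%N != 5%N ->
  C3 p *m v = 0 <-> locally_soluble n (encoded1 p v) (encoded2 p v).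
Proof.
move=> /negPf n1 /negPf n5; rewrite locally_solubleP // n1 n5 /= C_stack_mul.
rewrite row_real row_h1 row_h4 row_Y4.
split=> [[? ? ? ? /C_low_mul[]]|[? [? []] ? ? ? ? ?]] //.
by split=> //; apply/C_low_mul.
Qed.

End Rows.

Local Close Scope ring_scope.

Theorem theorem6p9 (t : nat) (p : 'I_t -> nat)
    (p_prime : forall i, prime (p i))
    (p_neq2 : forall i, p i <> 2) (p_neq3 : forall i, p i <> 3)
    (p_inj : injective p) :
  let nt := \prod_(i < t) p i in
  let n := (3 * nt)%N in
  [/\ nt = 3 %[mod 8] -> is_Monsky_matrix p n (C1 p),
      nt = 7 %[mod 8] -> is_Monsky_matrix p n (C2 p)
    & nt = 1 %[mod 4] -> is_Monsky_matrix p n (C3 p)].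
Proof.
move=> nt n.
have nE : (n : int) = (3 * \prod_i (p i)%:Z)%R.
  rewrite /n PoszM; congr (_ * _)%R.
  by apply: (big_morph Posz PoszM).
have n8 : `|(n %% 8)%Z| = (3 * nt) %% 8 by rewrite modz_nat.
rewrite nE in n8 *.
(* As n = 3 nt, the residues 3 and 7 of nt modulo 8 give n = 1 and n = 5 modulo 8, and nt = 1 modulo
   4 gives n = 3 or 7. *)
split=> nt8; apply: Monsky_of_locally_soluble => // v.
- by apply: C1_mul => //; rewrite n8; lia.
- by apply: C2_mul => //; rewrite n8; lia.
- by apply: C3_mul => //; rewrite n8; lia.
Qed.
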